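(* Let $(R,\mathfrak m)$ be a commutative Noetherian local ring, let $\mathfrak a$ be an ideal of $R$, and let $M$ be a finitely generated $R$-module. Then $$\dim_R M/\mathfrak a M = \sup\{ i \in \mathbb Z : \varprojlim_n H^i_{\mathfrak m}(M/\mathfrak a^n M) \neq 0\}.$$
   Context: $H^i_{\mathfrak m}(\cdot)$ denotes the $i$-th local cohomology functor with support in $\mathfrak m$. The inverse limit is taken over $n\in\mathbb N$ along the maps induced by the natural surjections $M/\mathfrak a^{n+1}M \to M/\mathfrak a^nM$. Conventions for degenerate cases: the dimension of the zero module and the supremum of the empty set are both $-\infty$. *)

(* Defs.v *)
From HB Require Import structures.
From mathcomp Require Import all_boot all_order all_algebra.
From mathcomp Require Import boolp classical_sets constructive_ereal.

Set Implicit Arguments.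
Unset Strict Implicit.
Unset Printing Implicit Defensive.

Import Order.TTheory GRing.Theory Num.Theory.
Local Open Scope ring_scope.
Local Open Scope quotient_scope.
Local Open Scope classical_set_scope.

Definition submodule_of (R : pzRingType) (V : lmodType R) (N : submodClosed V) :=
  {x : V | x \in N}.

Section SubmoduleOf.
Variables (R : pzRingType) (V : lmodType R) (N : submodClosed V).

HB.instance Definition _ := [isSub of submodule_of N for sval].
HB.instance Definition _ := [Choice of submodule_of N by <:].
HB.instance Definition _ := [SubChoice_isSubLmodule of submodule_of N by <:].

End SubmoduleOf.

Section SubMap.
Variables (R : pzRingType) (V W : lmodType R) (N : submodClosed V)
  (N' : submodClosed W) (f : {linear V -> W}) (fN : {homo f : x / x \in N >-> x \in N'}).

Definition sub_map (x : submodule_of N) : submodule_of N' :=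
  Sub (f (val x)) (fN (valP x)).

Lemma sub_map_is_linear : linear sub_map.
Proof. by move=> k x y; apply: val_inj; rewrite /= !linearP. Qed.
HB.instance Definition _ :=
  GRing.isLinear.Build R _ _ _ sub_map sub_map_is_linear.

End SubMap.

(* The library quotient [{ideal_quot N}] expects a [zmodClosed] predicate, which is not
   inferred from [submodClosed]. *)
Definition zmod_pred (R : pzRingType) (V : lmodType R) (N : submodClosed V) :
  {pred V} := [pred x | x \in N].

Fact zmod_pred_closed (R : pzRingType) (V : lmodType R) (N : submodClosed V) :
  zmod_closed (zmod_pred N).
Proof.
split=> [|x y]; rewrite !inE ?rpred0 // => xN yN.
by rewrite rpredD // -scaleN1r rpredZ.
Qed.
HB.instance Definition _ (R : pzRingType) (V : lmodType R) (N : submodClosed V) :=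
  GRing.isZmodClosed.Build V (zmod_pred N) (zmod_pred_closed N).

Definition quotient_by (R : pzRingType) (V : lmodType R) (N : submodClosed V) :=
  {ideal_quot (zmod_pred N)}.

Section QuotientBy.
Variables (R : pzRingType) (V : lmodType R) (N : submodClosed V).
Local Notation Q := (quotient_by N).

HB.instance Definition _ := EqQuotient.on Q.
HB.instance Definition _ := GRing.Zmodule.on Q.

Definition coset (x : V) : Q := \pi x.

Lemma cosetP x y : reflect (coset x = coset y) (x - y \in N).
Proof.
rewrite -[x - y \in N]/(x - y \in zmod_pred N) Quotient.idealrBE; exact: eqP.
Qed.

Definition quot_scale (k : R) (q : Q) : Q := coset (k *: repr q).

Lemma coset_repr (q : Q) : coset (repr q) = q.
Proof. exact: reprK. Qed.

Lemma coset_is_zmod_morphism : zmod_morphism coset.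
Proof. by move=> x y; exact: (raddfB (\pi_({ideal_quot (zmod_pred N)}))). Qed.
HB.instance Definition _ :=
  GRing.isZmodMorphism.Build V Q coset coset_is_zmod_morphism.

Lemma quot_scaleE k x : quot_scale k (coset x) = coset (k *: x).
Proof.
by apply/cosetP; rewrite -scalerBr rpredZ //; apply/cosetP; exact: coset_repr.
Qed.

Lemma quot_scaleA a b q : quot_scale a (quot_scale b q) = quot_scale (a * b) q.
Proof. by rewrite -[q]coset_repr !quot_scaleE scalerA. Qed.

Lemma quot_scale1 : left_id 1 quot_scale.
Proof. by move=> q; rewrite -[q]coset_repr quot_scaleE scale1r. Qed.

Lemma quot_scaleDr : right_distributive quot_scale +%R.
Proof.
move=> a q r; rewrite -[q]coset_repr -[r]coset_repr -raddfD !quot_scaleE.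
by rewrite scalerDr raddfD.
Qed.

Lemma quot_scaleDl q : {morph quot_scale^~ q : a b / a + b}.
Proof.
by move=> a b /=; rewrite -[q]coset_repr !quot_scaleE scalerDl raddfD.
Qed.

HB.instance Definition _ := GRing.Zmodule_isLmodule.Build R Q
  quot_scaleA quot_scale1 quot_scaleDr quot_scaleDl.

Lemma coset_is_scalable : scalable coset.
Proof. by move=> k x; rewrite -quot_scaleE. Qed.
HB.instance Definition _ :=
  GRing.isScalable.Build R V Q *:%R coset coset_is_scalable.

End QuotientBy.

Section QuotMap.
Variables (R : pzRingType) (V W : lmodType R) (N : submodClosed V)
  (N' : submodClosed W) (f : {linear V -> W}) (fN : {homo f : x / x \in N >-> x \in N'}).

(* [fN] is not needed to write the map, only to show that it does not depend
   on the representative; see [quot_mapE]. *)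
Definition quot_map of {homo f : x / x \in N >-> x \in N'} :=
  fun q : quotient_by N => coset N' (f (repr q)).

Lemma quot_mapE x : quot_map fN (coset N x) = coset N' (f x).
Proof.
by apply/cosetP; rewrite -raddfB; apply: fN; apply/cosetP; exact: coset_repr.
Qed.

Lemma quot_map_is_linear : linear (quot_map fN).
Proof.
move=> k x y; rewrite -[x]coset_repr -[y]coset_repr -linearP !quot_mapE.
by rewrite !linearP.
Qed.
HB.instance Definition _ :=
  GRing.isLinear.Build R _ _ _ (quot_map fN) quot_map_is_linear.

End QuotMap.

Section FullSubmodule.
Variables (R : pzRingType) (V : lmodType R).

Definition full_pred : {pred V} := predT.

Fact full_pred_closed : submod_closed full_pred.
Proof. by split. Qed.
HB.instance Definition _ :=
  GRing.isSubmodClosed.Build R V full_pred full_pred_closed.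

Definition full_submodule : submodClosed V := full_pred.

End FullSubmodule.

Definition finitely_generated (R : pzRingType) (V : lmodType R)
    (N : submodClosed V) :=
  exists n (v : 'I_n -> V), forall x,
    x \in N <-> exists r : 'I_n -> R, x = \sum_(i < n) r i *: v i.

Section Ideals.
Variable R : comNzRingType.
Implicit Types I J p m : submodClosed R^o.

Definition noetherian := forall I, finitely_generated I.

Definition prime_ideal p :=
  (1 : R^o) \notin p /\
  forall x y : R, x * y \in p -> x \in p \/ y \in p.

Definition maximal_ideal m :=
  (1 : R^o) \notin m /\
  forall I, {subset m <= I} -> (1 : R^o) \notin I -> {subset I <= m}.

Definition local_ring m :=
  maximal_ideal m /\ forall m', maximal_ideal m' -> m' =i m.

End Ideals.

Section IdealSmul.
Variables (R : comNzRingType) (V : lmodType R).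

Definition ideal_smul_pred (I : submodClosed R^o) (N : submodClosed V) : {pred V} :=
  [pred x | `[< exists n (r : 'I_n -> R) (v : 'I_n -> V),
    [/\ forall i, r i \in I, forall i, v i \in N
      & x = \sum_(i < n) r i *: v i] >]].

Fact ideal_smul_pred_closed I N : submod_closed (ideal_smul_pred I N).
Proof.
split; first by apply/asboolP; exists 0%N, (fun=> 0), (fun=> 0); split;
  [case | case | rewrite big_ord0].
move=> k x y /asboolP[n [r [v [rI vN ->]]]] /asboolP[n' [r' [v' [rI' vN' ->]]]].
apply/asboolP; exists (n + n')%N.
exists (fun i => match fintype.split i with inl j => k * r j | inr j => r' j end).
exists (fun i => match fintype.split i with inl j => v j | inr j => v' j end).
split.
- move=> i; case: fintype.split => j; last exact: rI'.
  exact: (@rpredZ R R^o I k (r j) (rI j)).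
- by move=> i; case: fintype.split => j; [exact: vN | exact: vN'].
- rewrite big_split_ord scaler_sumr; congr (_ + _); apply: eq_bigr => i _.
    by rewrite (unsplitK (inl i)) scalerA.
  by rewrite (unsplitK (inr i)).
Qed.
HB.instance Definition _ (I : submodClosed R^o) (N : submodClosed V) :=
  GRing.isSubmodClosed.Build R V (ideal_smul_pred I N)
    (ideal_smul_pred_closed I N).

Definition ideal_smul I N : submodClosed V := ideal_smul_pred I N.

Lemma ideal_smulS (I J : submodClosed R^o) N :
  {subset I <= J} -> {subset ideal_smul I N <= ideal_smul J N}.
Proof.
move=> sIJ x /asboolP[n [r [v [rI vN ->]]]]; apply/asboolP.
by exists n, r, v; split=> // i; exact: sIJ.
Qed.

Lemma ideal_smul_sub I N : {subset ideal_smul I N <= N}.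
Proof.
by move=> x /asboolP[n [r [v [_ vN ->]]]]; apply: rpred_sum => i _; exact: rpredZ.
Qed.

End IdealSmul.

Section IdealExp.
Variable R : comNzRingType.

Definition ideal_exp (I : submodClosed R^o) n : submodClosed R^o :=
  iter n (ideal_smul I) (full_submodule R^o).

Lemma ideal_expS I n : {subset ideal_exp I n.+1 <= ideal_exp I n}.
Proof. exact: ideal_smul_sub. Qed.

Lemma ideal_exp_le I n n' :
  (n <= n')%N -> {subset ideal_exp I n' <= ideal_exp I n}.
Proof.
move=> /subnK <-; elim: (n' - n)%N => // k ih x.
by rewrite addSn => /ideal_expS /ih.
Qed.

End IdealExp.

Section QuotientTower.
Variables (R : comNzRingType) (a : submodClosed R^o) (M : lmodType R).

Definition quot_exp n : lmodType R :=
  quotient_by (ideal_smul (ideal_exp a n) (full_submodule M)).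

Fact quot_exp_homo n : {homo (idfun : {linear M -> M}) :
  x / x \in ideal_smul (ideal_exp a n.+1) (full_submodule M) >->
      x \in ideal_smul (ideal_exp a n) (full_submodule M)}.
Proof. by move=> x; apply: ideal_smulS; exact: ideal_expS. Qed.

Definition quot_exp_proj n : {linear quot_exp n.+1 -> quot_exp n} :=
  quot_map (@quot_exp_homo n).

End QuotientTower.

(* The Krull dimension of the ring R / Ann V, with the primes of the quotient
   ring written as the primes of R that contain the annihilator. *)
Section KrullDim.
Variables (R : comNzRingType) (V : lmodType R).

Definition annihilates (r : R) := forall x : V, r *: x = 0.

Definition prime_chain k (p : nat -> submodClosed R^o) :=
  [/\ forall i, (i <= k)%N -> prime_ideal (p i),
      forall i r, (i <= k)%N -> annihilates r -> (r : R^o) \in p i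
    & forall i, (i < k)%N ->
        {subset p i <= p i.+1} /\ ~ {subset p i.+1 <= p i}].

Definition krull_dim : \bar int :=
  supremum -oo%E [set k%:Z%:E | k in [set k | exists p, prime_chain k p]].

End KrullDim.

Section Complexes.
Variable R : comNzRingType.

Record complex := Complex {
  term :> nat -> lmodType R;
  diff : forall i, {linear term i -> term i.+1};
  diff_diff : forall i x, diff i.+1 (diff i x) = 0 }.

Record chain_map (C D : complex) := ChainMap {
  chain_fun :> forall i, {linear C i -> D i};
  chain_mapP : forall i x, chain_fun i.+1 (diff C i x) = diff D i (chain_fun i x) }.

Definition cocycle_pred (C : complex) i : {pred C i} :=
  [pred x | diff C i x == 0].

Fact cocycle_pred_closed (C : complex) i : submod_closed (@cocycle_pred C i).
Proof.
split; first by rewrite inE linear0.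
by move=> k x y; rewrite !inE linearP => /eqP-> /eqP->; rewrite scaler0 addr0.
Qed.
HB.instance Definition _ (C : complex) (i : nat) :=
  GRing.isSubmodClosed.Build R (C i) (@cocycle_pred C i)
    (cocycle_pred_closed C i).

Definition cocycle (C : complex) i : submodClosed (C i) := @cocycle_pred C i.

Definition boundary (C : complex) i : set (C i) :=
  match i with 0 => [set 0] | j.+1 => range (diff C j) end.
Arguments boundary : clear implicits.

Definition coboundary_pred (C : complex) i : {pred submodule_of (cocycle C i)} :=
  [pred z | `[< boundary C i (val z) >]].

Fact coboundary_pred_closed (C : complex) i : submod_closed (@coboundary_pred C i).
Proof.
split; first by apply/asboolP; case: i => //= i; exists 0; rewrite ?linear0.
move=> k [x zx] [y zy] /asboolP/= bx /asboolP/= by_; apply/asboolP => /=.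
case: i x zx y zy bx by_ => [|i] x _ y _ /=.
  by move=> -> ->; rewrite scaler0 addr0.
by move=> [u _ <-] [v _ <-]; exists (k *: u + v); rewrite // linearP.
Qed.
HB.instance Definition _ (C : complex) (i : nat) :=
  GRing.isSubmodClosed.Build R _ (@coboundary_pred C i)
    (coboundary_pred_closed C i).

Definition coboundary (C : complex) i : submodClosed (submodule_of (cocycle C i)) :=
  @coboundary_pred C i.

Definition cohomology (C : complex) i : lmodType R := quotient_by (coboundary C i).

Section CohomologyMap.
Variables (C D : complex) (f : chain_map C D) (i : nat).

Fact cocycle_homo :
  {homo f i : x / x \in cocycle C i >-> x \in cocycle D i}.
Proof. by move=> x; rewrite !inE -chain_mapP => /eqP->; rewrite linear0. Qed.

Fact coboundary_homo : {homo sub_map cocycle_homo :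
  z / z \in coboundary C i >-> z \in coboundary D i}.
Proof.
move=> [x zx] /asboolP/= bx; apply/asboolP => /=.
move: bx => {zx}; case: i x => [|j] x /=; first by move=> ->; rewrite linear0.
by move=> [u _ <-]; exists (f j u); rewrite // chain_mapP.
Qed.

Definition cohomology_map : {linear cohomology C i -> cohomology D i} :=
  quot_map coboundary_homo.

End CohomologyMap.

End Complexes.

Section InjectiveResolutions.
Variable R : comNzRingType.

Definition injective_module (E : lmodType R) :=
  forall (A B : lmodType R) (f : {linear A -> B}) (g : {linear A -> E}),
    injective f -> exists h : {linear B -> E}, forall x, h (f x) = g x.

Record injective_resolution (V : lmodType R) := InjectiveResolution {
  res_complex :> complex R;
  res_injective : forall i, injective_module (res_complex i);
  res_aug : {linear V -> res_complex 0};
  res_aug_inj : injective res_aug;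
  res_aug_exact : forall x, diff res_complex 0 x = 0 <-> range res_aug x;
  res_exact : forall i x,
    diff res_complex i.+1 x = 0 <-> range (diff res_complex i) x }.

Record resolution_lift (V W : lmodType R) (f : {linear V -> W})
    (I : injective_resolution V) (J : injective_resolution W) :=
  ResolutionLift {
    lift_map :> chain_map I J;
    lift_aug : forall x, lift_map 0 (res_aug I x) = res_aug J (f x) }.

End InjectiveResolutions.

Section LocalCohomology.
Variables (R : comNzRingType) (m : submodClosed R^o).

Definition torsion_pred (V : lmodType R) : {pred V} :=
  [pred x | `[< exists n, forall r : R, r \in ideal_exp m n -> r *: x = 0 >]].

Fact torsion_pred_closed V : submod_closed (@torsion_pred V).
Proof.
split; first by apply/asboolP; exists 0%N => r _; rewrite scaler0.
move=> k x y /asboolP[n nx] /asboolP[n' ny]; apply/asboolP.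
exists (maxn n n') => r rm.
rewrite scalerDr scalerA mulrC -scalerA nx ?ny ?scaler0 ?addr0 //.
  exact: ideal_exp_le (leq_maxr n n') _ rm.
exact: ideal_exp_le (leq_maxl n n') _ rm.
Qed.
HB.instance Definition _ (V : lmodType R) :=
  GRing.isSubmodClosed.Build R V (@torsion_pred V) (torsion_pred_closed V).

Definition torsion (V : lmodType R) : submodClosed V := @torsion_pred V.

Fact torsion_homo (V W : lmodType R) (f : {linear V -> W}) :
  {homo f : x / x \in torsion V >-> x \in torsion W}.
Proof.
move=> x /asboolP[n nx]; apply/asboolP; exists n => r /nx rx.
by rewrite -linearZ rx linear0.
Qed.

Definition Gamma (V : lmodType R) : lmodType R := submodule_of (torsion V).

Definition Gamma_map (V W : lmodType R) (f : {linear V -> W}) :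
    {linear Gamma V -> Gamma W} :=
  sub_map (@torsion_homo V W f).

Fact Gamma_diff_diff (C : complex R) i x :
  Gamma_map (diff C i.+1) (Gamma_map (diff C i) x) = 0.
Proof. by apply: val_inj; rewrite /= diff_diff. Qed.

Definition Gamma_complex (C : complex R) : complex R :=
  @Complex R (fun i => Gamma (C i)) (fun i => Gamma_map (diff C i))
    (@Gamma_diff_diff C).

Fact Gamma_chain_mapP (C D : complex R) (f : chain_map C D) i x :
  Gamma_map (f i.+1) (diff (Gamma_complex C) i x) =
  diff (Gamma_complex D) i (Gamma_map (f i) x).
Proof. by apply: val_inj; rewrite /= chain_mapP. Qed.

Definition Gamma_chain_map (C D : complex R) (f : chain_map C D) :
    chain_map (Gamma_complex C) (Gamma_complex D) :=
  @ChainMap R (Gamma_complex C) (Gamma_complex D) (fun i => Gamma_map (f i))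
    (@Gamma_chain_mapP C D f).

(* The i-th right derived functor of Gamma at V, computed with an injective
   resolution I of V; it vanishes in negative degrees. Another choice of I, or
   of the lifts of the maps, changes it by canonical isomorphisms only, so
   statements about it quantify over all these choices. *)
Definition local_cohomology (V : lmodType R) (I : injective_resolution V)
    (i : int) : lmodType R :=
  match i with
  | Posz k => cohomology (Gamma_complex I) k
  | Negz _ => 'rV[R]_0
  end.

Definition local_cohomology_map (V W : lmodType R) (f : {linear V -> W})
    (I : injective_resolution V) (J : injective_resolution W)
    (phi : resolution_lift f I J) (i : int) :
    {linear local_cohomology I i -> local_cohomology J i} :=
  match i with
  | Posz k => cohomology_map (Gamma_chain_map phi) k
  | Negz _ => idfun
  end.

End LocalCohomology.

Definition seq_prod (R : pzRingType) (H : nat -> lmodType R) :=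
  forall n, H n.

Section SeqProd.
Variables (R : pzRingType) (H : nat -> lmodType R).
Local Notation P := (seq_prod H).
Implicit Types x y z : P.

HB.instance Definition _ := gen_eqMixin P.
HB.instance Definition _ := gen_choiceMixin P.

Let zero : P := fun=> 0.
Let opp x : P := fun n => - x n.
Let add x y : P := fun n => x n + y n.
Let scale (k : R) x : P := fun n => k *: x n.

Fact seq_prod_addA : associative add.
Proof. by move=> x y z; apply: functional_extensionality_dep => n; exact: addrA. Qed.
Fact seq_prod_addC : commutative add.
Proof. by move=> x y; apply: functional_extensionality_dep => n; exact: addrC. Qed.
Fact seq_prod_add0 : left_id zero add.
Proof. by move=> x; apply: functional_extensionality_dep => n; exact: add0r. Qed.
Fact seq_prod_addN : left_inverse zero opp add.
Proof. by move=> x; apply: functional_extensionality_dep => n; exact: addNr. Qed.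
HB.instance Definition _ := GRing.isZmodule.Build P
  seq_prod_addA seq_prod_addC seq_prod_add0 seq_prod_addN.

Fact seq_prod_scaleA a b x : scale a (scale b x) = scale (a * b) x.
Proof. by apply: functional_extensionality_dep => n; exact: scalerA. Qed.
Fact seq_prod_scale1 : left_id 1 scale.
Proof. by move=> x; apply: functional_extensionality_dep => n; exact: scale1r. Qed.
Fact seq_prod_scaleDr : right_distributive scale +%R.
Proof. by move=> a x y; apply: functional_extensionality_dep => n; exact: scalerDr. Qed.
Fact seq_prod_scaleDl x : {morph scale^~ x : a b / a + b}.
Proof. by move=> a b; apply: functional_extensionality_dep => n; exact: scalerDl. Qed.
HB.instance Definition _ := GRing.Zmodule_isLmodule.Build R P
  seq_prod_scaleA seq_prod_scale1 seq_prod_scaleDr seq_prod_scaleDl.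

End SeqProd.

Section InverseLimit.
Variables (R : pzRingType) (H : nat -> lmodType R)
  (t : forall n, {linear H n.+1 -> H n}).

Definition compatible_pred : {pred seq_prod H} :=
  [pred x | `[< forall n, t n (x n.+1) = x n >]].

Fact compatible_pred_closed : submod_closed compatible_pred.
Proof.
split; first by apply/asboolP => n; exact: linear0.
move=> k x y /asboolP tx /asboolP ty; apply/asboolP => n.
by rewrite [LHS]linearP tx ty.
Qed.
HB.instance Definition _ := GRing.isSubmodClosed.Build R (seq_prod H)
  compatible_pred compatible_pred_closed.

Definition inverse_limit : lmodType R :=
  submodule_of (compatible_pred : submodClosed (seq_prod H)).

End InverseLimit.

Definition nonzero_module (R : pzRingType) (V : lmodType R) :=
  exists x : V, x <> 0.

(* Main.v *)
(** Write x_1, ..., x_s for generators of m.  For one element x, the map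
    D_x = shift - x on the finitely supported sequences in a module has kernel
    the x-torsion and cokernel N_x / N, so iterating the cone of D_x over the x_i
    gives an exact functor from modules to complexes that is quasi-isomorphic to
    the Cech complex and needs no localization.  Its cohomology H^i vanishes in
    positive degrees on injective modules (Baer's extension property passes to
    x-torsion by the ascending chain condition), so dimension shifting along the
    syzygies of an injective resolution identifies it with local cohomology.

    If dim N <= d, then H^i(N) = 0 for i > d: filter N by its y-torsion for the
    generators y, and on modules where y is regular induct through N/yN.  Hence
    the tower H^d(M/a^n M), d = dim M/aM, has surjective transition maps, and the
    theorem reduces to Grothendieck's nonvanishing H^d(N) <> 0 for d = dim N.

    For nonvanishing, call a module small of level c if it is artinian and no
    nonzero subquotient is a quotient of some H^c'(N) with dim N <= c' and
    c <= c'.  By induction, H^i(N) is small of level i + 1.  Let p be prime,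
    A = R/p, and q > p a prime for which dim R/q = c is maximal; take f in q \ p.
    If H^(c+1)(A) = 0, then H^c(A/f) = G/fG with G = H^c(A) artinian, so
    f^n G = f^(n+1) G for some n and G/fG is a quotient of 0 :_G f^n, itself a
    quotient of H^(c-1)(A/f^n); by smallness H^c(A/f) = 0, although it surjects
    onto H^c(R/q) <> 0. *)

Require Import Defs.
From HB Require Import structures.
From mathcomp Require Import all_boot all_order all_algebra.
From mathcomp Require Import boolp classical_sets constructive_ereal.
From mathcomp Require Import ring.

Set Implicit Arguments.
Unset Strict Implicit.
Unset Printing Implicit Defensive.

Import GRing.Theory.
Local Open Scope ring_scope.

(** * Modules *)

Section LinearOf.
Variables (R : pzRingType) (V W : lmodType R).

Definition linear_of (f : V -> W) of linear f := f.

Lemma linear_of_is_linear f (hf : linear f) : linear (linear_of hf).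
Proof. exact: hf. Qed.
HB.instance Definition _ f (hf : linear f) :=
  GRing.isLinear.Build R V W _ (linear_of hf) (linear_of_is_linear hf).

Definition lin f (hf : linear f) : {linear V -> W} := linear_of hf.

Lemma linE f (hf : linear f) x : lin hf x = f x.
Proof. by []. Qed.

End LinearOf.

(* [linearZ] and [linearB] also match scalings and opposites themselves, which
   these variants do not. *)
Section LinearTheory.
Variables (R : pzRingType) (V W : lmodType R) (f : {linear V -> W}).

Lemma linB x y : f (x - y) = f x - f y. Proof. exact: linearB. Qed.
Lemma linZ k x : f (k *: x) = k *: f x. Proof. exact: linearZ. Qed.

End LinearTheory.

Section Submodules.
Variables (R : pzRingType) (V : lmodType R).

(** Submodules described by existential formulas stay [Prop]-valued; [sub_of] turns them into
    [submodClosed] predicates when a submodule or a quotient has to be formed. *)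
Definition is_sub (P : V -> Prop) :=
  P 0 /\ forall k x y, P x -> P y -> P (k *: x + y).

Lemma is_subD P x y : is_sub P -> P x -> P y -> P (x + y).
Proof. by move=> [_ hP] Px Py; rewrite -[x]scale1r; exact: hP. Qed.

Lemma is_subZ P k x : is_sub P -> P x -> P (k *: x).
Proof. by move=> [P0 hP] Px; rewrite -[_ *: _]addr0; exact: hP. Qed.

Lemma is_subN P x : is_sub P -> P x -> P (- x).
Proof. by rewrite -scaleN1r; exact: is_subZ. Qed.

Lemma is_subB P x y : is_sub P -> P x -> P y -> P (x - y).
Proof. by move=> hP Px Py; apply: is_subD => //; exact: is_subN. Qed.

Definition prop_pred (P : V -> Prop) of is_sub P : {pred V} := [pred x | `[< P x >]].

Fact prop_pred_closed P (hP : is_sub P) : submod_closed (prop_pred hP).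
Proof.
split; first by apply/asboolP; case: hP.
by move=> k x y /asboolP Px /asboolP Py; apply/asboolP; case: hP => _; apply.
Qed.
HB.instance Definition _ P (hP : is_sub P) :=
  GRing.isSubmodClosed.Build R V (prop_pred hP) (prop_pred_closed hP).

Definition sub_of P (hP : is_sub P) : submodClosed V := prop_pred hP.

Lemma sub_ofP P (hP : is_sub P) x : x \in sub_of hP <-> P x.
Proof. by split; move/asboolP. Qed.

Lemma mem_is_sub (N : submodClosed V) : is_sub (fun x => x \in N).
Proof.
split; first exact: rpred0.
by move=> k x y xN yN; rewrite rpredD ?rpredZ.
Qed.

Section Inclusion.
Variables (P : V -> Prop) (hP : is_sub P).

Definition subm : lmodType R := submodule_of (sub_of hP).

Definition subm_val (x : subm) : V := val x.

Fact subm_val_is_linear : linear subm_val.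
Proof. by move=> k x y; rewrite /subm_val linearP. Qed.

Definition incl : {linear subm -> V} := lin subm_val_is_linear.

Lemma incl_inj : injective incl.
Proof. by move=> x y /val_inj. Qed.

Lemma inclP (x : subm) : P (incl x).
Proof. by apply/(sub_ofP hP)/(valP x). Qed.

Lemma incl_onto x : P x -> exists y, incl y = x.
Proof. by move=> /(sub_ofP hP) Px; exists (Sub x Px). Qed.

Definition quo : lmodType R := quotient_by (sub_of hP).

Fact coset_is_linear : linear (coset (sub_of hP)).
Proof. by move=> k x y; rewrite linearP. Qed.

Definition proj : {linear V -> quo} := lin coset_is_linear.

Lemma proj_onto y : exists x, proj x = y.
Proof. by exists (repr y); exact: coset_repr. Qed.

Lemma proj_eq0 x : proj x = 0 <-> P x.
Proof.
rewrite -(linear0 proj) /= -(sub_ofP hP) -[x in x \in _]subr0.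
by split => [h|h]; apply/cosetP.
Qed.

End Inclusion.

Lemma incl_iff P (hP : is_sub P) x : P x <-> exists y, incl hP y = x.
Proof. by split=> [|[y <-]]; [exact: incl_onto | exact: inclP]. Qed.

End Submodules.

Section MoreLinear.
Variable R : pzRingType.
Implicit Types V W X : lmodType R.

Lemma ker_is_sub V W (f : {linear V -> W}) : is_sub (fun x => f x = 0).
Proof. by split=> [|k x y fx fy]; rewrite ?linear0 // linearP fx fy scaler0 addr0. Qed.

Lemma im_is_sub V W (f : {linear V -> W}) : is_sub (fun y => exists x, f x = y).
Proof.
split; first by exists 0; rewrite linear0.
by move=> k _ _ [x <-] [y <-]; exists (k *: x + y); rewrite linearP.
Qed.

Lemma preim_is_sub V W (f : {linear V -> W}) (P : W -> Prop) :
  is_sub P -> is_sub (fun x => P (f x)).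
Proof. by move=> hP; split=> [|k x y Px Py]; rewrite ?linear0 ?linearP; apply hP. Qed.

Lemma im_sub_is_sub V W (f : {linear V -> W}) (P : V -> Prop) :
  is_sub P -> is_sub (fun y => exists2 x, P x & f x = y).
Proof.
move=> hP; split; first by exists 0; rewrite ?linear0 //; case: hP.
by move=> k _ _ [x Px <-] [y Py <-]; exists (k *: x + y); rewrite ?linearP //; apply hP.
Qed.

Lemma comp_is_linear V W X (f : {linear V -> W}) (g : {linear W -> X}) :
  linear (fun x => g (f x)).
Proof. by move=> k x y; rewrite !linearP. Qed.

Definition compl V W X (f : {linear V -> W}) (g : {linear W -> X}) :
  {linear V -> X} := lin (comp_is_linear f g).

(** This is a submodule of V × W. Connecting maps, maps out of quotients and subquotients are first
    given by such relations. *)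
Definition lin_rel V W (r : V -> W -> Prop) :=
  r 0 0 /\ forall k x y x' y', r x y -> r x' y' -> r (k *: x + x') (k *: y + y').

Lemma lin_relB V W (r : V -> W -> Prop) x y x' y' :
  lin_rel r -> r x y -> r x' y' -> r (x - x') (y - y').
Proof.
by move=> [_ hr] h h'; move: (hr (-1) _ _ _ _ h' h); rewrite !scaleN1r ![- _ + _]addrC.
Qed.

(** Two values at one point differ by a value at 0, so single-valuedness only has to be checked at
    0. *)
Lemma lin_rel_map V W (r : V -> W -> Prop) :
  lin_rel r -> (forall x, exists y, r x y) -> (forall y, r 0 y -> y = 0) ->
  exists h : {linear V -> W}, forall x y, r x y <-> y = h x.
Proof.
move=> hr tot fun0.
have fctl x y y' : r x y -> r x y' -> y = y'.
  move=> h h'; apply/eqP; rewrite -subr_eq0; apply/eqP/fun0.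
  by rewrite -[0](subrr x); exact: lin_relB.
pose h x := projT1 (cid (tot x)).
have hP x : r x (h x) by rewrite /h; case: cid.
have hl : linear h.
  by move=> k x y; apply: fctl (hP _) _; case: hr => _; apply.
by exists (lin hl) => x y; split=> [rxy|->]; [exact: fctl rxy (hP x) | exact: hP].
Qed.

Lemma factor_map V W X (p : {linear V -> W}) (h : {linear V -> X}) :
  (forall y, exists x, p x = y) -> (forall x, p x = 0 -> h x = 0) ->
  exists h' : {linear W -> X}, forall x, h' (p x) = h x.
Proof.
move=> ponto kerp.
have [|y|y [x px <-]|h' hE] :=
  @lin_rel_map W X (fun y z => exists2 x, p x = y & h x = z).
- split; first by exists 0; rewrite linear0.
  move=> k _ _ _ _ [x <- <-] [x' <- <-].
  by exists (k *: x + x'); rewrite linearP.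
- by have [x px] := ponto y; exists (h x), x.
- exact: kerp.
by exists h' => x; apply/esym/hE; exists x.
Qed.

Lemma lift_map V W X (i : {linear W -> X}) (h : {linear V -> X}) :
  injective i -> (forall x, exists y, i y = h x) ->
  exists h' : {linear V -> W}, forall x, i (h' x) = h x.
Proof.
move=> iinj him.
have [|x|y|h' hE] := @lin_rel_map V W (fun x y => i y = h x).
- split; first by rewrite !linear0.
  by move=> k x y x' y' e e'; rewrite !linearP e e'.
- exact: him.
- by rewrite linear0 => iy; apply: iinj; rewrite iy linear0.
by exists h' => x; apply/hE.
Qed.

Definition trivial V := forall x : V, x = 0.

Definition ses V W X (f : {linear V -> W}) (g : {linear W -> X}) :=
  [/\ injective f, forall y, g y = 0 <-> exists x, f x = y
    & forall z, exists y, g y = z].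

Lemma ses_comp0 V W X (f : {linear V -> W}) (g : {linear W -> X}) x :
  ses f g -> g (f x) = 0.
Proof. by move=> [_ ex _]; apply/ex; exists x. Qed.

Lemma ses_sub V (P : V -> Prop) (hP : is_sub P) : ses (incl hP) (proj hP).
Proof.
split; [exact: incl_inj | | exact: proj_onto].
by move=> y; rewrite proj_eq0; exact: incl_iff.
Qed.

Lemma ses_onto V W (g : {linear V -> W}) :
  (forall z, exists y, g y = z) -> ses (incl (ker_is_sub g)) g.
Proof. by split=> //; [exact: incl_inj | move=> y; exact: incl_iff]. Qed.

Lemma ses_inj V W (f : {linear V -> W}) :
  injective f -> ses f (proj (im_is_sub f)).
Proof. by split=> //; [move=> y; exact: proj_eq0 | exact: proj_onto]. Qed.

End MoreLinear.

Section Scaling.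
Variables (R : comNzRingType) (V : lmodType R).

Fact mulby_is_linear (r : R) : linear (fun x : V => r *: x).
Proof. by move=> k x y; rewrite scalerDr !scalerA mulrC. Qed.

Definition mulby r : {linear V -> V} := lin (mulby_is_linear r).

Lemma mulbyE r x : mulby r x = r *: x. Proof. by []. Qed.

End Scaling.

Lemma scalerX_exp (R : comNzRingType) (V : lmodType R) (r : R) i j (x : V) :
  r ^+ (i + j) *: x = r ^+ i *: (r ^+ j *: x).
Proof. by rewrite scalerA exprD. Qed.

(** * Complexes and the long exact sequence *)

Section Shift.
Variable R : comNzRingType.
Implicit Types C D : complex R.

(** The term in degree i - 1, with a zero module below degree 0, so that coboundaries are images of
    [pdiff] in all degrees alike. *)
Definition prev C i : lmodType R := if i is j.+1 then C j else 'rV[R]_0.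

Fact zero_is_linear (V W : lmodType R) : linear (fun _ : V => 0 : W).
Proof. by move=> k x y; rewrite scaler0 addr0. Qed.

Definition pdiff C i : {linear prev C i -> C i} :=
  match i with
  | 0 => lin (@zero_is_linear 'rV[R]_0 (C 0))
  | j.+1 => diff C j
  end.

Lemma diff_pdiff C i w : diff C i (pdiff C i w) = 0.
Proof. by case: i w => [|i] w /=; rewrite ?linear0 ?diff_diff. Qed.

Definition pmap C D (f : chain_map C D) i : {linear prev C i -> prev D i} :=
  match i with
  | 0 => lin (@zero_is_linear 'rV[R]_0 'rV[R]_0)
  | j.+1 => f j
  end.

Lemma pmapP C D (f : chain_map C D) i w :
  f i (pdiff C i w) = pdiff D i (pmap f i w).
Proof. by case: i w => [|i] w /=; rewrite ?linear0 ?chain_mapP. Qed.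

Lemma prev0_eq0 C (w : prev C 0) : w = 0.
Proof. by apply/rowP => -[]. Qed.

Lemma boundaryE C i (x : C i) : @boundary R C i x <-> exists w, pdiff C i w = x.
Proof.
case: i x => [|i] x /=; split.
- by move=> x0; exists 0; rewrite x0.
- by move=> [w wx]; rewrite -wx.
- by move=> [w _ <-]; exists w.
- by move=> [w <-]; exists w.
Qed.

(** Diagram chases run on cochains through this relation instead of on cosets of a subtype. *)
Definition rep C i (u : cohomology C i) (x : C i) :=
  exists z : submodule_of (cocycle C i), val z = x /\ coset (coboundary C i) z = u.

Section Rep.
Variables (C : complex R) (i : nat).
Implicit Types (u v : cohomology C i) (x y : C i).

Lemma rep_ex u : exists x, rep u x.
Proof. by exists (val (repr u)), (repr u); split=> //; exact: coset_repr. Qed.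

Lemma rep_cocycle u x : rep u x -> diff C i x = 0.
Proof. by move=> [z [<- _]]; apply/eqP; exact: (valP z). Qed.

Lemma cocycle_rep x : diff C i x = 0 -> exists u, rep u x.
Proof.
move=> /eqP dx; have xZ : x \in cocycle C i by [].
by exists (coset _ (Sub x xZ)), (Sub x xZ).
Qed.

Lemma rep_lin : lin_rel (@rep C i).
Proof.
split; first by exists 0; rewrite !linear0.
move=> k _ _ _ _ [z [<- <-]] [z' [<- <-]].
by exists (k *: z + z'); rewrite !linearP.
Qed.

Lemma repZ k u x : rep u x -> rep (k *: u) (k *: x).
Proof.
by move=> ux; rewrite -[_ *: u]addr0 -[_ *: x]addr0; apply: rep_lin.2 => //; apply: rep_lin.1.
Qed.

Lemma rep_eq0 u x : rep u x -> (u = 0 <-> exists w, pdiff C i w = x).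
Proof.
move=> [z [<- <-]]; rewrite -boundaryE.
have -> : coset (coboundary C i) z = 0 <-> z \in coboundary C i.
  rewrite -(linear0 (coset (coboundary C i))) -[z in z \in _]subr0.
  by split=> h; apply/cosetP.
by split; move/asboolP.
Qed.

Lemma rep0 x : rep 0 x <-> exists w, pdiff C i w = x.
Proof.
split=> [h|[w h]]; first exact/(rep_eq0 h).
have [|u ux] := @cocycle_rep x; first by rewrite -h diff_pdiff.
by have /(rep_eq0 ux) <- : exists w, pdiff C i w = x by exists w.
Qed.

Lemma rep_uniq u v x : rep u x -> rep v x -> u = v.
Proof.
move=> h h'; apply/eqP; rewrite -subr_eq0; apply/eqP.
by apply/(rep_eq0 (lin_relB rep_lin h h')); exists 0; rewrite linear0 subrr.
Qed.

Lemma rep_add_boundary u x w : rep u x -> rep u (x - pdiff C i w).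
Proof.
move=> h; rewrite -[u]subr0; apply: (lin_relB rep_lin h).
by apply/rep0; exists w.
Qed.

End Rep.

Lemma rep_map C D (f : chain_map C D) i u x :
  rep u x -> rep (cohomology_map f i u) (f i x).
Proof.
move=> [z [<- <-]]; exists (@Defs.sub_map R _ _ _ _ (f i) (@cocycle_homo R C D f i) z); split=> //.
exact/esym/(quot_mapE (@coboundary_homo R C D f i) z).
Qed.

End Shift.

Section LongExact.
Variable R : comNzRingType.

Definition sesC (A B C : complex R) (f : chain_map A B) (g : chain_map B C) :=
  forall i, ses (f i) (g i).

Section Les.
Variables (A B C : complex R) (f : chain_map A B) (g : chain_map B C).
Hypothesis S : sesC f g.

Lemma ses_prev i : ses (pmap f i) (pmap g i).
Proof.
case: i => [|i]; last exact: S.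
split; first by move=> x y _; rewrite (prev0_eq0 x) (prev0_eq0 y).
  by move=> y; split=> // _; exists 0; rewrite (prev0_eq0 y).
by move=> z; exists 0; rewrite (prev0_eq0 z).
Qed.

(** The snake: [b] lifts a cocycle of the class [u], and its differential comes from the cocycle
    [a]. *)
Definition delta_rel i (u : cohomology C i) (v : cohomology A i.+1) :=
  exists b a, [/\ rep u (g i b), rep v a & f i.+1 a = diff B i b].

Lemma exists_delta i : exists h : {linear cohomology C i -> cohomology A i.+1},
  forall u v, delta_rel u v <-> v = h u.
Proof.
apply: lin_rel_map.
- split; first by exists 0, 0; rewrite !linear0; split=> //; apply rep_lin.
  move=> k u v u' v' [b [a [h1 h2 h3]]] [b' [a' [h1' h2' h3']]].
  exists (k *: b + b'), (k *: a + a'); rewrite !linearP h3 h3'.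
  by split=> //; apply rep_lin.
- move=> u; have [x ux] := rep_ex u; have [_ _ /(_ x)[b gb]] := S i.
  have [inj ex _] := S i.+1.
  have /ex[a fa] : g i.+1 (diff B i b) = 0.
    by rewrite chain_mapP gb (rep_cocycle ux).
  have [|v va] := @cocycle_rep R A i.+1 a.
    have [inj2 _ _] := S i.+2.
    by apply: inj2; rewrite chain_mapP fa diff_diff linear0.
  by exists v, b, a; rewrite gb.
(* Single-valuedness: if [g i b] is the boundary of [w], subtracting the boundary of a lift of [w]
   moves [b] into the image of A, which makes [a] a boundary. *)
- move=> v [b [a [/rep0[w gb] va fa]]].
  have [_ _ /(_ w)[w' gw]] := ses_prev i.
  have [_ ex _] := S i.
  have /ex[a0 fa0] : g i (b - pdiff B i w') = 0.
    by rewrite linearB /= pmapP gw gb subrr.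
  apply/(rep_eq0 va); exists a0.
  have [inj _ _] := S i.+1; apply: inj.
  by rewrite fa /= chain_mapP fa0 linearB /= diff_pdiff subr0.
Qed.

Definition delta i := projT1 (cid (exists_delta i)).

Lemma deltaP i u v : delta_rel u v <-> v = delta i u.
Proof. by rewrite /delta; case: cid. Qed.

Lemma delta_relE i u : delta_rel u (delta i u).
Proof. exact/deltaP. Qed.

Lemma les_mid i u : cohomology_map g i u = 0 <-> exists v, cohomology_map f i v = u.
Proof.
split=> [|[v <-]]; last first.
  have [a va] := rep_ex v; apply/(rep_eq0 (rep_map g (rep_map f va))).
  by exists 0; rewrite linear0 (ses_comp0 _ (S i)).
have [b ub] := rep_ex u => /(rep_eq0 (rep_map g ub))[w gb].
have [_ _ /(_ w)[w' gw]] := ses_prev i.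
have [_ ex _] := S i.
have /ex[a fa] : g i (b - pdiff B i w') = 0.
  by rewrite linearB /= pmapP gw gb subrr.
have [|v va] := @cocycle_rep R A i a.
  have [inj _ _] := S i.+1; apply: inj.
  by rewrite chain_mapP fa linearB /= diff_pdiff (rep_cocycle ub) subrr linear0.
exists v; apply: rep_uniq (rep_map f va) _.
by rewrite fa; exact: rep_add_boundary.
Qed.

Lemma les_delta i u : delta i u = 0 <-> exists v, cohomology_map g i v = u.
Proof.
split=> [du|[v <-]].
  have := delta_relE u; rewrite du => -[b [a [ub /rep0[a0 /= da] fa]]].
  have [|v vb] := @cocycle_rep R B i (b - f i a0).
    by rewrite linearB /= -chain_mapP da fa subrr.
  exists v; apply: rep_uniq (rep_map g vb) _.
  by rewrite linearB /= (ses_comp0 _ (S i)) subr0.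
have [b vb] := rep_ex v; apply/esym/deltaP; exists b, 0; split.
- exact: rep_map.
- by apply rep_lin.
- by rewrite linear0 (rep_cocycle vb).
Qed.

Lemma les_next i v : cohomology_map f i.+1 v = 0 <-> exists u, delta i u = v.
Proof.
split=> [|[u <-]].
  have [a va] := rep_ex v => /(rep_eq0 (rep_map f va))[b /= fa].
  have [|u ub] := @cocycle_rep R C i (g i b).
    by rewrite -chain_mapP fa (ses_comp0 _ (S i.+1)).
  by exists u; apply/esym/deltaP; exists b, a.
have [b [a [ub va fa]]] := delta_relE u.
by apply/(rep_eq0 (rep_map f va)); exists b.
Qed.

Lemma les_inj0 : injective (cohomology_map f 0).
Proof.
apply: raddf_inj => u; have [x ux] := rep_ex u.
move=> /(rep_eq0 (rep_map f ux))[w /= fx]; apply/(rep_eq0 ux); exists 0.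
have [inj _ _] := S 0; apply: inj.
by rewrite -fx !linear0.
Qed.

End Les.

Lemma delta_nat (A B C A' B' C' : complex R) (f : chain_map A B)
    (g : chain_map B C) (f' : chain_map A' B') (g' : chain_map B' C')
    (S : sesC f g) (S' : sesC f' g') (p : chain_map A A') (q : chain_map B B')
    (r : chain_map C C') i u :
  (forall j x, q j (f j x) = f' j (p j x)) ->
  (forall j x, r j (g j x) = g' j (q j x)) ->
  delta S' i (cohomology_map r i u) = cohomology_map p i.+1 (delta S i u).
Proof.
move=> qf rg; apply/esym/deltaP.
have [b [a [ub va fa]]] := delta_relE S u.
exists (q i b), (p i.+1 a); split.
- by rewrite -rg; exact: rep_map.
- exact: rep_map.
- by rewrite -qf fa chain_mapP.
Qed.

End LongExact.

(** * Telescopes *)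

Section FiniteSequences.
Variable R : comNzRingType.
Implicit Types V W X : lmodType R.

Definition finsupp V (f : seq_prod (fun _ : nat => V)) :=
  exists n, forall k, (n <= k)%N -> f k = 0.

Fact finsupp_is_sub V : is_sub (@finsupp V).
Proof.
split; first by exists 0%N.
move=> a f g [n hf] [p hg]; exists (maxn n p) => k.
rewrite geq_max => /andP[/hf fk /hg gk].
by rewrite -[LHS]/(a *: f k + g k) fk gk scaler0 addr0.
Qed.

Definition finseq V : lmodType R := subm (@finsupp_is_sub V).

Fact ev_is_linear V k : linear (fun f : finseq V => incl (@finsupp_is_sub V) f k).
Proof. by move=> a f g; rewrite linearP. Qed.

Definition ev V k : {linear finseq V -> V} := lin (@ev_is_linear V k).

Lemma finseq_ext V (f g : finseq V) : (forall k, ev V k f = ev V k g) -> f = g.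
Proof.
by move=> fg; apply: (@incl_inj _ _ _ (@finsupp_is_sub V)); apply/funext => k; exact: fg.
Qed.

Lemma ev_fin V (f : finseq V) : exists n, forall k, (n <= k)%N -> ev V k f = 0.
Proof. exact: (inclP f). Qed.

Lemma finseq_intro V (F : nat -> V) n : (forall k, (n <= k)%N -> F k = 0) ->
  exists f : finseq V, forall k, ev V k f = F k.
Proof.
move=> hF; have [|f fE] := @incl_onto _ _ _ (@finsupp_is_sub V) F; first by exists n.
by exists f => k; rewrite -fE.
Qed.

Lemma finseq_intro_map V W (F : V -> nat -> W) :
  (forall k, linear (F^~ k)) -> (forall v, exists n, forall k, (n <= k)%N -> F v k = 0) ->
  exists h : {linear V -> finseq W}, forall v k, ev W k (h v) = F v k.
Proof.
move=> hlin hfin.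
have ex v : exists f : finseq W, forall k, ev W k f = F v k.
  by have [n hn] := hfin v; exact: finseq_intro hn.
pose h v := projT1 (cid (ex v)).
have hE v k : ev W k (h v) = F v k by rewrite /h; case: cid.
have hl : linear h.
  by move=> a v w; apply: finseq_ext => k; rewrite linearP !hE hlin.
by exists (lin hl) => v k; rewrite -hE.
Qed.

Fact finseq_map_ex V W (h : {linear V -> W}) :
  exists Th : {linear finseq V -> finseq W}, forall f k, ev W k (Th f) = h (ev V k f).
Proof.
apply: finseq_intro_map => [k a f g|f]; first by rewrite !linearP.
by have [n hn] := ev_fin f; exists n => k /hn ->; rewrite linear0.
Qed.

Definition finseq_map V W (h : {linear V -> W}) := projT1 (cid (finseq_map_ex h)).

Lemma finseq_mapE V W (h : {linear V -> W}) f k : ev W k (finseq_map h f) = h (ev V k f).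
Proof. by rewrite /finseq_map; case: cid. Qed.

Fact tdiff_ex V (x : R) : exists D : {linear finseq V -> finseq V},
  forall f k, ev V k (D f) = ev V k.+1 f - x *: ev V k f.
Proof.
apply: finseq_intro_map => [k a f g|f].
  by rewrite !linearP /= scalerDr addrACA.
have [n hn] := ev_fin f; exists n => k nk.
by rewrite !hn ?scaler0 ?subr0 // (leq_trans nk).
Qed.

Definition tdiff V x := projT1 (cid (tdiff_ex V x)).

Lemma tdiffE V x f k : ev V k (tdiff V x f) = ev V k.+1 f - x *: ev V k f.
Proof. by rewrite /tdiff; case: cid. Qed.

Lemma tdiff_map V W (h : {linear V -> W}) x f :
  tdiff W x (finseq_map h f) = finseq_map h (tdiff V x f).
Proof. by apply: finseq_ext => k; rewrite tdiffE !finseq_mapE tdiffE linearB /= [h (_ *: _)]linearZ. Qed.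

Lemma finseq_map_lift V W (h : {linear V -> W}) (f : finseq W) :
  (forall k, exists v, h v = ev W k f) -> exists f', finseq_map h f' = f.
Proof.
(* Entries equal to 0 are lifted to 0, which keeps the lifted sequence finitely supported. *)
move=> ex; have ex' k : exists v, h v = ev W k f /\ (ev W k f = 0 -> v = 0).
  have [fk0|fk] := pselect (ev W k f = 0); first by exists 0; rewrite fk0 linear0.
  by have [v hv] := ex k; exists v.
have [F hF] := choice ex'; have [n hn] := ev_fin f.
have [k nk|f' f'E] := @finseq_intro _ F n; first by have [_] := hF k; apply; exact: hn.
by exists f'; apply: finseq_ext => k; rewrite finseq_mapE f'E; have [] := hF k.
Qed.

Lemma finseq_map_comp V W X (h : {linear V -> W}) (h' : {linear W -> X}) f :
  (forall v, h' (h v) = 0) -> finseq_map h' (finseq_map h f) = 0.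
Proof. by move=> hh; apply: finseq_ext => k; rewrite !finseq_mapE hh linear0. Qed.

Lemma finseq_map_ses V W X (h : {linear V -> W}) (h' : {linear W -> X}) :
  ses h h' -> ses (finseq_map h) (finseq_map h').
Proof.
move=> [inj ex onto]; split.
- move=> f g fg; apply: finseq_ext => k; apply: inj.
  by rewrite -!finseq_mapE fg.
- move=> f; split=> [hf|[g <-]].
    by apply: finseq_map_lift => k; apply/ex; rewrite -finseq_mapE hf linear0.
  by apply: finseq_map_comp => v; apply/ex; exists v.
- by move=> f; apply: finseq_map_lift => k; exact: onto.
Qed.

End FiniteSequences.

Section Telescope.
Variable R : comNzRingType.
Implicit Types C D : complex R.

Section Def.
Variables (x : R) (C : complex R).

(** The shifted cone of [tdiff]: finite sequences in degree i of C, together with those in degree i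
    - 1. *)
Definition tele_term i : lmodType R := (finseq (C i) * finseq (prev C i))%type.

Definition tele_fun i (p : tele_term i) : tele_term i.+1 :=
  (finseq_map (diff C i) p.1, tdiff (C i) x p.1 - finseq_map (pdiff C i) p.2).

Fact tele_fun_is_linear i : linear (@tele_fun i).
Proof.
move=> a p q; rewrite /tele_fun !linearP; congr (_, _).
by rewrite /= scalerDr addrACA.
Qed.

Definition tele_diff i : {linear tele_term i -> tele_term i.+1} :=
  lin (@tele_fun_is_linear i).

Fact tele_diff_diff i p : tele_diff i.+1 (tele_diff i p) = 0.
Proof.
rewrite !linE /tele_fun /=; congr (_, _).
  exact/finseq_map_comp/diff_diff.
rewrite tdiff_map linearB /= [X in _ - (_ - X)]finseq_map_comp ?subr0 ?subrr //.
exact: diff_pdiff.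
Qed.

Definition tele : complex R := Complex tele_diff_diff.

Lemma tele_diffE i (p : tele i) :
  diff tele i p = (finseq_map (diff C i) p.1, tdiff (C i) x p.1 - finseq_map (pdiff C i) p.2).
Proof. by []. Qed.

Lemma tele_diff_eq0 i (p : tele i) : diff tele i p = 0 <->
  finseq_map (diff C i) p.1 = 0 /\ tdiff (C i) x p.1 = finseq_map (pdiff C i) p.2.
Proof.
rewrite tele_diffE; split=> [e|[-> ->]]; last by rewrite subrr.
split; first exact: (congr1 fst e).
by apply/eqP; rewrite -subr_eq0; apply/eqP; exact: (congr1 snd e).
Qed.

End Def.

Section Map.
Variables (x : R) (C D : complex R) (f : chain_map C D).

Definition tele_map_fun i (p : tele x C i) : tele x D i :=
  (finseq_map (f i) p.1, finseq_map (pmap f i) p.2).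

Fact tele_map_is_linear i : linear (@tele_map_fun i).
Proof. by move=> a p q; rewrite /tele_map_fun !linearP. Qed.

Fact tele_map_chain i p :
  lin (@tele_map_is_linear i.+1) (diff (tele x C) i p) =
  diff (tele x D) i (lin (@tele_map_is_linear i) p).
Proof.
rewrite !linE /tele_map_fun /=; congr (_, _).
  by apply: finseq_ext => k; rewrite !finseq_mapE chain_mapP.
rewrite tdiff_map linearB /=; congr (_ - _).
by apply: finseq_ext => k; rewrite !finseq_mapE pmapP.
Qed.

Definition tele_map : chain_map (tele x C) (tele x D) := ChainMap tele_map_chain.

Lemma tele_mapE i p : tele_map i p = (finseq_map (f i) p.1, finseq_map (pmap f i) p.2).
Proof. by []. Qed.

End Map.

Lemma tele_ses x A B C (f : chain_map A B) (g : chain_map B C) :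
  sesC f g -> sesC (tele_map x f) (tele_map x g).
Proof.
move=> S i; have [inj1 ex1 on1] := finseq_map_ses (S i).
have [inj2 ex2 on2] := finseq_map_ses (ses_prev S i).
split.
- by move=> [p1 p2] [q1 q2]; rewrite !tele_mapE => -[/inj1 -> /inj2 ->].
- move=> [p1 p2]; rewrite tele_mapE; split=> [[/= /ex1[q1 e1] /ex2[q2 e2]]|[[q1 q2]]].
    by exists (q1, q2); rewrite tele_mapE e1 e2.
  rewrite tele_mapE => -[/= e1 e2]; congr (_, _); first by apply/ex1; exists q1.
  by apply/ex2; exists q2.
- move=> [r1 r2]; have [q1 e1] := on1 r1; have [q2 e2] := on2 r2.
  by exists (q1, q2); rewrite tele_mapE e1 e2.
Qed.

End Telescope.

(** * Modules as complexes in degree 0 *)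

Section Concentrated.
Variable R : comNzRingType.

Definition conc_term (N : lmodType R) (i : nat) : lmodType R :=
  if i is 0 then N else 'rV[R]_0.

Definition conc (N : lmodType R) : complex R :=
  @Complex R (conc_term N)
    (fun i => lin (@zero_is_linear R (conc_term N i) (conc_term N i.+1)))
    (fun i x => erefl).

Definition conc_fun (M N : lmodType R) (f : {linear M -> N}) i :
    {linear conc M i -> conc N i} :=
  match i with
  | 0 => f
  | j.+1 => lin (@zero_is_linear R 'rV[R]_0 'rV[R]_0)
  end.

Fact conc_chain (M N : lmodType R) (f : {linear M -> N}) i x :
  conc_fun f i.+1 (diff (conc M) i x) = diff (conc N) i (conc_fun f i x).
Proof. by []. Qed.

Definition conc_map (M N : lmodType R) (f : {linear M -> N}) : chain_map (conc M) (conc N) :=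
  ChainMap (conc_chain f).

Lemma rV0_eq0 (x : 'rV[R]_0) : x = 0.
Proof. by apply/rowP => -[]. Qed.

Lemma conc_ses (A B C : lmodType R) (f : {linear A -> B}) (g : {linear B -> C}) :
  ses f g -> sesC (conc_map f) (conc_map g).
Proof.
move=> S [|i] //; split.
- by move=> x y _; rewrite (rV0_eq0 x) (rV0_eq0 y).
- by move=> y; split=> // _; exists 0; rewrite (rV0_eq0 y).
- by move=> z; exists 0; rewrite (rV0_eq0 z).
Qed.

End Concentrated.

(** * The Cech complex of a sequence *)

Section Cech.
Variable R : comNzRingType.
Implicit Types (A B C D M N : lmodType R) (x : R) (xs : seq R).

Lemma prev0_eq (C : complex R) (w w' : prev C 0) : w = w'.
Proof. by rewrite (prev0_eq0 w) (prev0_eq0 w'). Qed.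

Lemma conc_eq N i (z z' : conc N i.+1) : z = z'.
Proof. by rewrite (rV0_eq0 z) (rV0_eq0 z'). Qed.

Fixpoint cech xs N : complex R := if xs is x :: xs' then tele x (cech xs' N) else conc N.

Fixpoint cech_map xs M N (f : {linear M -> N}) : chain_map (cech xs M) (cech xs N) :=
  if xs is x :: xs' return chain_map (cech xs M) (cech xs N)
  then tele_map x (cech_map xs' f) else conc_map f.

Arguments cech : simpl never.
Arguments cech_map : simpl never.

Definition cechH xs i N : lmodType R := cohomology (cech xs N) i.

Definition cechH_map xs i M N (f : {linear M -> N}) : {linear cechH xs i M -> cechH xs i N} :=
  cohomology_map (cech_map xs f) i.

Lemma cech_ses xs A B C (f : {linear A -> B}) (g : {linear B -> C}) :
  ses f g -> sesC (cech_map xs f) (cech_map xs g).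
Proof.
by move=> S; elim: xs => [|x xs ih] /=; [exact: conc_ses | exact: tele_ses].
Qed.

(** Functoriality in the form of commuting squares, as the naturality of connecting maps requires
    it. *)
Lemma cech_map_square xs A B C D (f : {linear A -> B}) (g : {linear B -> D})
    (f' : {linear A -> C}) (g' : {linear C -> D}) :
  (forall a, g (f a) = g' (f' a)) ->
  forall i z, cech_map xs g i (cech_map xs f i z) = cech_map xs g' i (cech_map xs f' i z).
Proof.
move=> e; elim: xs => [|x xs ih] i; first by case: i.
move=> [p q]; rewrite /= !tele_mapE /=; congr (_, _); apply: finseq_ext => k.
  by rewrite !finseq_mapE.
by rewrite !finseq_mapE; case: i q {p} => [|i] q; [exact: prev0_eq | exact: ih].
Qed.

Lemma cech_map_ext xs M N (f g : {linear M -> N}) :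
  (forall a, f a = g a) -> forall i z, cech_map xs f i z = cech_map xs g i z.
Proof.
move=> e; elim: xs => [|x xs ih] i; first by case: i.
move=> [p q]; rewrite /= !tele_mapE /=; congr (_, _); apply: finseq_ext => k.
  by rewrite !finseq_mapE.
by rewrite !finseq_mapE; case: i q {p} => [|i] q; [exact: prev0_eq | exact: ih].
Qed.

Lemma cech_map_scale xs N (f : {linear N -> N}) x :
  (forall a, f a = x *: a) -> forall i z, cech_map xs f i z = x *: z.
Proof.
move=> e; elim: xs => [|y xs ih] i; first by case: i => [|i] z; [exact: e | exact: conc_eq].
move=> [p q]; rewrite /= tele_mapE /=; congr (_, _); apply: finseq_ext => k.
  by rewrite finseq_mapE ih linearZ.
rewrite finseq_mapE [RHS]linearZ /=.
by case: i q {p} => [|i] q; [exact: prev0_eq | exact: ih].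
Qed.

Lemma cechH_map_ext xs M N (f g : {linear M -> N}) i u :
  (forall a, f a = g a) -> cechH_map xs i f u = cechH_map xs i g u.
Proof.
move=> /(@cech_map_ext xs) e; have [z uz] := rep_ex u.
by apply: rep_uniq (rep_map _ uz) _; rewrite e; exact: rep_map.
Qed.

Lemma cechH_map_scale xs N (f : {linear N -> N}) x i u :
  (forall a, f a = x *: a) -> cechH_map xs i f u = x *: u.
Proof.
move=> /(@cech_map_scale xs) e; have [z uz] := rep_ex u.
apply: rep_uniq (rep_map _ uz) _.
by rewrite e; exact: repZ.
Qed.

Lemma cech_trivial xs i N : trivial N -> trivial (cech xs N i).
Proof.
move=> hN; elim: xs i => [|x xs ih] i.
  by case: i => [|i] z; [exact: hN | exact: (@conc_eq N i z 0)].
move=> [p q]; congr (_, _); apply: finseq_ext => k; rewrite [RHS]linear0; first exact: ih.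
by case: i q {p} => [|i] q; [exact: prev0_eq | exact: ih].
Qed.

Lemma cechH_trivial_of_K xs i N : trivial (cech xs N i) -> trivial (cechH xs i N).
Proof.
move=> hK u; have [z uz] := rep_ex u.
by apply/(rep_eq0 uz); exists 0; rewrite linear0 (hK z).
Qed.

Lemma cechH_trivial xs i N : trivial N -> trivial (cechH xs i N).
Proof. by move=> hN; apply: cechH_trivial_of_K; exact: cech_trivial. Qed.

(** The concentrated complex lives in degree 0, and each telescope adds one degree. *)
Lemma cech_above xs i N : (size xs < i)%N -> trivial (cech xs N i).
Proof.
elim: xs i => [|x xs ih] [|i] //= si; first by move=> z; exact: (@conc_eq N i z 0).
move=> [p q]; congr (_, _); apply: finseq_ext => k; rewrite [RHS]linear0.
  by apply: ih; rewrite ltnW.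
exact: ih.
Qed.

Lemma cechH_above xs i N : (size xs < i)%N -> trivial (cechH xs i N).
Proof. by move=> si; apply: cechH_trivial_of_K; exact: cech_above. Qed.

Definition killed_by_power x N (v : N) := exists n, x ^+ n *: v = 0.

(** Each element of [xs] has its own exponent; when [xs] generates an ideal m, [torsionE] identifies
    this with m-torsion. *)
Definition tors xs N (v : N) := forall x, x \in xs -> killed_by_power x v.

Lemma killed_le x N (v : N) n k : (n <= k)%N -> x ^+ n *: v = 0 -> x ^+ k *: v = 0.
Proof. by move=> /subnK <- h; rewrite scalerX_exp h scaler0. Qed.

Lemma killed_is_sub x N : is_sub (@killed_by_power x N).
Proof.
split; first by exists 0%N; rewrite scaler0.
move=> k v w [n hn] [p hp]; exists (maxn n p).
rewrite scalerDr (killed_le (leq_maxr _ _) hp) addr0 scalerA mulrC -scalerA.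
by rewrite (killed_le (leq_maxl _ _) hn) scaler0.
Qed.

Lemma tors_is_sub xs N : is_sub (@tors xs N).
Proof.
split; first by move=> x _; apply (killed_is_sub x N).
by move=> k v w hv hw x xxs; apply (killed_is_sub x N); [exact: hv | exact: hw].
Qed.

Lemma killed_map x M N (f : {linear M -> N}) v :
  killed_by_power x v -> killed_by_power x (f v).
Proof. by move=> [n hn]; exists n; rewrite -linearZ hn linear0. Qed.

Lemma tors_map xs M N (f : {linear M -> N}) v : tors xs v -> tors xs (f v).
Proof. by move=> h x /h; exact: killed_map. Qed.

(** * Cohomology in degree 0 as the torsion submodule *)

Section EvalZero.
Variable N : lmodType R.

(** Evaluates each nested sequence at index 0; a cocycle of degree 0 is determined by the resulting
    value. *)
Fixpoint e0_fun xs : cech xs N 0 -> N :=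
  if xs is x :: xs' return cech xs N 0 -> N
  then fun p => e0_fun (ev (cech xs' N 0) 0 p.1) else fun v => v.

Fact e0_is_linear xs : linear (@e0_fun xs).
Proof. by elim: xs => //= x xs ih a p q; rewrite /= linearP ih. Qed.

Definition e0 xs : {linear cech xs N 0 -> N} := lin (@e0_is_linear xs).

(** In degree 0 the second component is zero, so a cocycle is killed by shift - x, that is,
    geometric with ratio x. *)
Lemma tele_cocycle0 x (C : complex R) (p : tele x C 0) :
  diff (tele x C) 0 p = 0 <->
  finseq_map (diff C 0) p.1 = 0 /\ forall k, ev (C 0) k p.1 = x ^+ k *: ev (C 0) 0 p.1.
Proof.
have pd0 : finseq_map (pdiff C 0) p.2 = 0 by apply: finseq_ext => k; rewrite finseq_mapE linear0.
rewrite tele_diff_eq0 pd0; split=> [[-> D0]|[-> hk]]; split=> //.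
  elim=> [|k ih]; first by rewrite expr0 scale1r.
  by apply/eqP; rewrite exprS -scalerA -ih -subr_eq0 -tdiffE D0 linear0.
apply: finseq_ext => k; rewrite linear0 tdiffE hk [in X in _ - X]hk.
by rewrite exprS scalerA subrr.
Qed.

Lemma e0_inj xs z : diff (cech xs N) 0 z = 0 -> e0 xs z = 0 -> z = 0.
Proof.
elim: xs z => [|x xs ih] z; first by [].
move=> /(@tele_cocycle0 x (cech xs N))[df hk] e.
have f0 : ev _ 0 z.1 = 0 by apply: ih e; rewrite -finseq_mapE df linear0.
case: z df hk e f0 => [f g] df hk e f0.
congr (_, _); apply: finseq_ext => k; rewrite [RHS]linear0; last exact: prev0_eq.
by rewrite hk f0 scaler0.
Qed.

Lemma e0_tors xs z : diff (cech xs N) 0 z = 0 -> tors xs (e0 xs z).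
Proof.
elim: xs z => [|x xs ih] z; first by [].
move=> /(@tele_cocycle0 x (cech xs N))[df hk] y.
have ez : e0 (x :: xs) z = e0 xs (ev (cech xs N 0) 0 z.1) by [].
rewrite inE => /orP[/eqP-> | yxs]; rewrite ez.
  have [n hn] := ev_fin z.1; exists n.
  by rewrite -linearZ -hk hn ?linear0.
by apply: ih => //; rewrite -finseq_mapE df linear0.
Qed.

Lemma e0_onto xs v : tors xs v -> exists z, diff (cech xs N) 0 z = 0 /\ e0 xs z = v.
Proof.
elim: xs => [|x xs ih] hv; first by exists v.
have [|z [dz ez]] := ih; first by move=> y yxs; apply: hv; rewrite inE yxs orbT.
have [n hn] : killed_by_power x v by apply: hv; rewrite mem_head.
(* This makes the geometric sequence on [z] finitely supported. As [z] is a cocycle, it can be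
   checked after evaluation, where it is the torsion of [v]. *)
have hz : x ^+ n *: z = 0.
  by apply: e0_inj; rewrite linearZ ?dz ?ez /= ?scaler0.
have [k nk|f fE] := @finseq_intro R (cech xs N 0) (fun k => x ^+ k *: z) n.
  exact: killed_le nk hz.
exists (f, 0); split.
  apply/(@tele_cocycle0 x (cech xs N)); split=> [|k]; last by rewrite !fE expr0 scale1r.
  by apply: finseq_ext => k; rewrite finseq_mapE fE linearZ /= dz scaler0 linear0.
by rewrite -ez -[RHS]/(e0 xs z) -[z in RHS]scale1r -(expr0 x) -fE.
Qed.

End EvalZero.

Lemma e0_nat xs M N (f : {linear M -> N}) z : e0 N xs (cech_map xs f 0 z) = f (e0 M xs z).
Proof.
elim: xs z => [|x xs ih] z; first by [].
rewrite -[RHS]/(f (e0 M xs (ev _ 0 z.1))).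
by rewrite -ih -finseq_mapE.
Qed.

Lemma cechH0_incl xs N : exists h : {linear cechH xs 0 N -> N},
  [/\ injective h, forall u z, rep u z -> h u = e0 N xs z
    & forall v, tors xs v <-> exists u, h u = v].
Proof.
have [|u|v|h hE] := @lin_rel_map _ (cechH xs 0 N) N
    (fun u v => exists2 z, rep u z & e0 N xs z = v).
- split; first by exists 0; rewrite ?linear0 //; apply rep_lin.
  move=> k u v u' v' [z uz <-] [z' uz' <-].
  by exists (k *: z + z'); rewrite ?linearP //; apply rep_lin.
- by have [z uz] := rep_ex u; exists (e0 N xs z), z.
- by move=> [z /rep0[w <-] <-]; rewrite (prev0_eq0 w) !linear0.
have hR u z : rep u z -> h u = e0 N xs z by move=> uz; apply/esym/hE; exists z.
exists h; split=> //.
- apply: raddf_inj => u; have [z uz] := rep_ex u.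
  move=> hu; have z0 : z = 0 by apply: e0_inj (rep_cocycle uz) _; rewrite -(hR _ _ uz).
  by apply/(rep_eq0 uz); exists 0; rewrite linear0 z0.
- move=> v; split=> [/e0_onto[z [dz <-]]|[u <-]].
    by have [u uz] := cocycle_rep dz; exists u; exact: hR.
  by have [z uz] := rep_ex u; rewrite (hR _ _ uz); apply: e0_tors; exact: rep_cocycle uz.
Qed.

(** * Torsion of the cohomology *)

Section Torsion.

Definition coh_tors (C : complex R) x := forall i z, diff C i z = 0 ->
  exists n w, pdiff C i w = x ^+ n *: z.

(** The operator shift - x is null-homotopic on the cone: on a cocycle (f, g) of positive degree it
    gives the boundary of (g, 0), in degree 0 it gives 0. Hence x acts on cohomology as the shift,
    and iterating the shift kills finitely supported sequences. *)
Lemma tele_tors_self x (C : complex R) : coh_tors (tele x C) x.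
Proof.
move=> i [f g] dz.
have hom (p : tele x C i) : diff (tele x C) i p = 0 ->
    exists w, pdiff (tele x C) i w = (tdiff _ x p.1, tdiff _ x p.2).
  move=> /tele_diff_eq0[_ Dp].
  case: i p Dp {f g dz} => [|i] p Dp.
    exists 0; rewrite linear0 Dp; congr (_, _); apply: finseq_ext => k.
      by rewrite finseq_mapE !linear0.
    exact: prev0_eq.
  by exists (p.2, 0); rewrite /= tele_diffE /= Dp [finseq_map _ 0]linear0 subr0.
have [n1 hf0] := ev_fin f; have [n2 hg0] := ev_fin g.
exists (maxn n1 n2).
have [hf hg] : (forall k, (maxn n1 n2 <= k)%N -> ev _ k f = 0) /\
    (forall k, (maxn n1 n2 <= k)%N -> ev _ k g = 0).
  by split=> k; rewrite geq_max => /andP[h1 h2]; [exact: hf0 | exact: hg0].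
elim: (maxn _ _) f g dz hf hg {hf0 hg0} => [|n ih] f g dz hf hg.
  exists 0; rewrite linear0 expr0 scale1r; congr (_, _); apply: finseq_ext => k.
    by rewrite hf // linear0.
  by rewrite hg // linear0.
have [w hw] := hom _ dz.
(* Adding x to shift - x leaves the shift, which shortens the support by one. *)
have [|||w' hw'] := ih (x *: f + tdiff _ x f) (x *: g + tdiff _ x g).
- have -> : (x *: f + tdiff _ x f, x *: g + tdiff _ x g) =
    x *: ((f, g) : tele x C i) + pdiff (tele x C) i w by rewrite hw.
  by rewrite linearP dz diff_pdiff scaler0 addr0.
- by move=> k nk; rewrite linearP tdiffE addrC subrK hf.
- by move=> k nk; rewrite linearP tdiffE addrC subrK hg.
exists (w' - x ^+ n *: w); rewrite linearB [X in _ - X]linearZ /= hw' hw.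
rewrite -scalerBr exprSr -scalerA; congr (_ *: _).
by congr (_, _); rewrite addrK.
Qed.

(** Finite support bounds the exponents of the entries, so one power of x serves all of them. *)
Lemma finseq_tors x (C : complex R) i (f : finseq (C i)) :
  coh_tors C x -> finseq_map (diff C i) f = 0 ->
  exists n u, finseq_map (pdiff C i) u = x ^+ n *: f.
Proof.
move=> hC df.
have /choice[n hn] k : exists n, exists w, pdiff C i w = x ^+ n *: ev _ k f.
  by apply: hC; rewrite -finseq_mapE df linear0.
have [p hp] := ev_fin f.
exists (\max_(k < p) n k)%N; apply: finseq_map_lift => k.
rewrite linearZ /=; have [pk|kp] := leqP p k.
  by exists 0; rewrite hp // scaler0 linear0.
have [w hw] := hn k.
have nk : (n k <= \max_(k < p) n k)%N by exact: (leq_bigmax (Ordinal kp)).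
exists (x ^+ (\max_(k < p) n k - n k) *: w).
by rewrite linearZ /= hw -scalerX_exp subnK.
Qed.

(** A power of y makes the first component a boundary. Removing it leaves a cocycle in the second
    component, which another power of y makes a boundary; the exponents add up. *)
Lemma tele_tors_other y x (C : complex R) : coh_tors C y -> coh_tors (tele x C) y.
Proof.
move=> hC i [f g] dz; have /tele_diff_eq0[df _] := dz.
have [n [u hu]] := finseq_tors hC df.
case: i f g dz df u hu => [|i] f g dz df u hu.
  exists n, 0; rewrite linear0 -[RHS]/(y ^+ n *: f, y ^+ n *: g) -hu.
  congr (_, _); apply: finseq_ext => k; first by rewrite finseq_mapE !linear0.
  exact: prev0_eq.
pose g' : finseq (C i) := y ^+ n *: g - tdiff _ x u.
have ez : y ^+ n *: ((f, g) : tele x C i.+1) =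
    diff (tele x C) i (u, 0) + ((0, g') : tele x C i.+1).
  rewrite tele_diffE /= [finseq_map _ 0]linear0 subr0 hu.
  by congr (_, _); rewrite /= ?addr0 // /g' addrC subrK.
have dg' : finseq_map (diff C i) g' = 0.
  have : diff (tele x C) i.+1 ((0, g') : tele x C i.+1) = 0.
    have -> : ((0, g') : tele x C i.+1) =
      y ^+ n *: ((f, g) : tele x C i.+1) - diff (tele x C) i (u, 0).
      by rewrite ez addrC addKr.
    by rewrite linB linZ dz scaler0 diff_diff subrr.
  by move=> /tele_diff_eq0[_ /= <-]; rewrite linear0.
have [n' [u' hu']] := finseq_tors hC dg'.
exists (n' + n)%N, (y ^+ n' *: ((u, 0) : tele x C i) - ((0, u') : tele x C i)).
have e : diff (tele x C) i (0, u') = - (y ^+ n' *: ((0, g') : tele x C i.+1)).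
  rewrite tele_diffE [(0, u').1]/= [(0, u').2]/= !linear0 hu' sub0r.
  by rewrite -[RHS]/(- (y ^+ n' *: 0), - (y ^+ n' *: g')) scaler0 oppr0.
by rewrite scalerX_exp ez scalerDr linB linZ /= e opprK.
Qed.

Lemma cech_tors xs N y : y \in xs -> coh_tors (cech xs N) y.
Proof.
elim: xs => //= x xs ih; rewrite inE => /orP[/eqP->|/ih]; first exact: tele_tors_self.
exact: tele_tors_other.
Qed.

Lemma cechH_tors xs i N (u : cechH xs i N) : tors xs u.
Proof.
move=> y /(cech_tors (N := N)) h; have [z uz] := rep_ex u.
have [n [w hw]] := h i z (rep_cocycle uz); exists n.
by apply/(rep_eq0 (repZ _ uz)); exists w.
Qed.

End Torsion.

(** * A criterion for vanishing in positive degrees *)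

Section Acyclic.

(** The condition says that e equals -w/x^n after inverting x, so that the torsion for the tail maps
    onto its localization at x. *)
Fixpoint acyc xs N : Prop :=
  if xs is x :: xs' then
    acyc xs' N /\ forall n (w : N), tors xs' w ->
      exists (e : N) l, tors xs' e /\ x ^+ l *: (x ^+ n *: e + w) = 0
  else True.

(** The cohomology of the cone is built from kernel and cokernel of shift - x on that of C. With C
    acyclic in positive degrees, the only obstruction is the cokernel in degree 0. *)
Lemma tele_acyclic x (C : complex R) :
  (forall i z, diff C i.+1 z = 0 -> exists w, diff C i w = z) ->
  (forall g, finseq_map (diff C 0) g = 0 ->
     exists h, finseq_map (diff C 0) h = 0 /\ tdiff _ x h = g) ->
  forall i z, diff (tele x C) i.+1 z = 0 -> exists w, diff (tele x C) i w = z.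
Proof.
move=> ac onto i [f g] dz.
have exT j h : finseq_map (diff C j.+1) h = 0 -> exists u, finseq_map (diff C j) u = h.
  by move=> dh; apply: finseq_map_lift => k; apply: ac; rewrite -finseq_mapE dh linear0.
have [u hu] : exists u, finseq_map (diff C i) u = f.
  by apply: exT; case/tele_diff_eq0: dz.
pose g' : finseq (C i) := g - tdiff _ x u.
have ez : ((f, g) : tele x C i.+1) =
    diff (tele x C) i (u, 0) + ((0, g') : tele x C i.+1).
  rewrite tele_diffE /= [finseq_map _ 0]linear0 subr0 hu.
  by congr (_, _); rewrite /= ?addr0 // /g' addrC subrK.
have dg' : finseq_map (diff C i) g' = 0.
  have : diff (tele x C) i.+1 ((0, g') : tele x C i.+1) = 0.
    have -> : ((0, g') : tele x C i.+1) =
      ((f, g) : tele x C i.+1) - diff (tele x C) i (u, 0).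
      by rewrite ez addrC addKr.
    by rewrite linearB dz diff_diff subrr.
  by move=> /tele_diff_eq0[_ /= <-]; rewrite linear0.
suff [w hw] : exists w, diff (tele x C) i w = (0, g').
  by exists (((u, 0) : tele x C i) + w); rewrite linearD hw ez.
move: (g') dg' => h dh; case: i {f g u hu dz g' ez} h dh exT => [|i] h dh exT.
  have [v [dv Dv]] := onto _ dh; exists (v, 0); rewrite tele_diffE /= dv Dv.
  by rewrite linear0 subr0.
have {exT} [v hv] : exists v, finseq_map (diff C i) v = h.
  by apply: finseq_map_lift => k; apply: ac; rewrite -finseq_mapE dh linear0.
exists (0, - v); rewrite tele_diffE /= !linear0 linearN sub0r opprK.
by rewrite hv.
Qed.

Lemma cech_acyclic xs N : acyc xs N ->
  forall i z, diff (cech xs N) i.+1 z = 0 -> exists w, diff (cech xs N) i w = z.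
Proof.
elim: xs => [|x xs ih].
  by move=> _ i z _; exists 0; exact: conc_eq.
move=> [/ih{}ih onto]; apply: tele_acyclic => // g dg.
(* Solving (shift - x) h = g means h_(k+1) = x h_k + g_k. The initial value [z] is free and has to
   be chosen so that h ends in zeros. *)
pose F z := fix F k := if k is k'.+1 then x *: F k' + ev _ k' g else z.
have Flin z k : F z k = x ^+ k *: z + F 0 k.
  elim: k => [|k ihk] /=; first by rewrite expr0 scale1r addr0.
  by rewrite ihk scalerDr addrA scalerA exprS.
have dF z k : diff (cech xs N) 0 z = 0 -> diff (cech xs N) 0 (F z k) = 0.
  move=> dz; elim: k => //= k ihk; rewrite linearP ihk scaler0 add0r.
  by rewrite -finseq_mapE dg linear0.
have [n hn] := ev_fin g.
(* From index n on the recursion only multiplies by x, so h vanishes from l + n on as soon as x^l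
   (x^n z + [F 0 n]) = 0. *)
have [e [l [te hl]]] := onto n (e0 N xs (F 0 n)) (e0_tors (dF 0 n (linear0 _))).
have [z [dz ez]] := e0_onto te.
have Fnl : F z (l + n)%N = 0.
  have -> : F z (l + n)%N = x ^+ l *: F z n.
    elim: l {hl} => [|l ihl]; first by rewrite expr0 scale1r.
    by rewrite addSn /= ihl hn ?leq_addl // addr0 scalerA exprS.
  apply: e0_inj; first by rewrite linZ (dF z n dz) scaler0.
  by rewrite linZ Flin linearP ez.
have [k nk|h hE] := @finseq_intro R _ (F z) (l + n)%N.
  have -> : k = (k - (l + n) + (l + n))%N by rewrite subnK.
  elim: (k - _)%N => // j ihj; rewrite addSn /= ihj scaler0 add0r hn //.
  by rewrite addnA leq_addl.
exists h; split; apply: finseq_ext => k.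
  by rewrite finseq_mapE hE dF // linear0.
by rewrite tdiffE !hE /= addrC addKr.
Qed.

Lemma cechH_acyc xs i N : acyc xs N -> trivial (cechH xs i.+1 N).
Proof.
move=> /cech_acyclic h u; have [z uz] := rep_ex u.
by apply/(rep_eq0 uz); apply: h; exact: rep_cocycle uz.
Qed.

(** Inverting x turns an x-torsion module into 0, so e = 0 works. *)
Lemma tors_acyc xs N : (forall v : N, tors xs v) -> acyc xs N.
Proof.
elim: xs => //= x xs ih hN; split.
  by apply: ih => v y yxs; apply: hN; rewrite inE yxs orbT.
move=> n w _; have [l hl] := hN w x (mem_head _ _).
exists 0, l; rewrite scaler0 add0r; split=> //.
by apply tors_is_sub.
Qed.

End Acyclic.

End Cech.

(** * Chain conditions and injective modules *)

Section Chains.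
Variable R : comNzRingType.
Implicit Types V W : lmodType R.

Definition noeth V := forall X : nat -> V -> Prop, (forall n, is_sub (X n)) ->
  (forall n v, X n v -> X n.+1 v) ->
  exists n, forall k v, (n <= k)%N -> X k v -> X n v.

Lemma ascend V (X : nat -> V -> Prop) n k v :
  (forall n v, X n v -> X n.+1 v) -> (n <= k)%N -> X n v -> X k v.
Proof. by move=> inc /subnK <-; elim: (k - n)%N => //= j ih /ih /inc. Qed.

Lemma noetherian_noeth : noetherian R -> noeth R^o.
Proof.
move=> hR X hX inc.
have hU : is_sub (fun v => exists n, X n v).
  split; first by exists 0%N; apply hX.
  move=> k v w [n hn] [p hp]; exists (maxn n p); apply hX.
    exact: ascend (leq_maxl n p) hn.
  exact: ascend (leq_maxr n p) hp.
have [n [g hg]] := hR (sub_of hU).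
have /choice[p hp] i : exists p, X p (g i).
  apply/(sub_ofP hU)/hg; exists (fun j => (j == i)%:R).
  rewrite (bigD1 i) //= eqxx scale1r big1 ?addr0 // => j /negPf ->.
  by rewrite scale0r.
exists (\max_i p i)%N => k v _ Xv.
have /hg[r ->] : v \in sub_of hU by apply/sub_ofP; exists k.
set q := (\max_i p i)%N; have hq := hX q.
apply: (@big_ind _ (X q)); first by apply hq.
  by move=> y z; exact: is_subD.
move=> i _; apply: is_subZ => //.
exact: ascend (leq_bigmax i) (hp i).
Qed.

Section Baer.
Variables (E : lmodType R) (R_noeth : noeth R^o).

(* Linear maps from ideals to P, given by their graphs r, extend to R. *)
Definition baer (P : E -> Prop) := forall r : R^o -> E -> Prop, lin_rel r ->
  (forall y, r 0 y -> y = 0) -> (forall a y, r a y -> P y) ->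
  exists e, P e /\ forall a y, r a y -> y = (a : R) *: e.

Lemma injective_baer : injective_module E -> baer (fun _ => True).
Proof.
move=> inj r hr r0 _.
have hJ : is_sub (fun a => exists y, r a y).
  split; first by exists 0; apply hr.
  by move=> k a b [y ra] [z rb]; exists (k *: y + z); apply hr.
have [|a|y|g gE] := @lin_rel_map R (subm hJ) E (fun a y => r (incl hJ a) y).
- split; first by rewrite linear0; apply hr.
  by move=> k a y b z ra rb; rewrite linearP; apply hr.
- exact: (inclP a).
- by rewrite linear0; exact: r0.
have [h hE] := inj _ _ (incl hJ) g (incl_inj (hP := hJ)).
exists (h 1); split=> // a y ra.
have [|b ba] := @incl_onto _ _ _ hJ a; first by exists y.
have /gE -> : r (incl hJ b) y by rewrite ba.
by rewrite -hE ba -linZ; congr (h _); rewrite -[RHS]/(a * 1) mulr1.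
Qed.

(** Extending the map x^(l+n) t ↦ -x^l t w from a principal ideal to R divides -w by x^n up to a
    factor x^l. It is well defined when the annihilators of the powers of x are stationary from l
    on. *)
Lemma baer_divide (P : E -> Prop) x n w : is_sub P -> baer P -> P w ->
  exists (e : E) l, P e /\ x ^+ l *: (x ^+ n *: e + w) = 0.
Proof.
move=> hP bP Pw.
have [||l hl] := R_noeth (X := fun l (t : R) => x ^+ l * t = 0).
- move=> l; split=> [|k s t hs ht]; first by rewrite mulr0.
  by rewrite mulrDr -[k *: s]/(k * s) mulrCA hs ht mulr0 addr0.
- by move=> l t ht; rewrite exprS -mulrA ht mulr0.
pose r (a : R^o) y := exists t, a = x ^+ (l + n) * t /\ y = (x ^+ l * t) *: (- w).
have [|y [t [at0 ->]]|a y [t [_ ->]]|e [Pe he]] := bP r.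
- split; first by exists 0; rewrite !mulr0 scale0r.
  move=> k a y a' y' [t [-> ->]] [t' [-> ->]]; exists (k * t + t'); split.
    by rewrite mulrDr mulrCA.
  by rewrite mulrDr scalerDl mulrCA !scalerA.
- by rewrite (hl (l + n)%N t) ?leq_addr // scale0r.
- by apply: is_subZ => //; apply: is_subN.
exists e, l; split=> //.
have := he (x ^+ (l + n)) (x ^+ l *: - w); rewrite scalerDr -scalerX_exp => <-.
  by rewrite scalerN addNr.
by exists 1; rewrite !mulr1.
Qed.

(** An elementary Artin-Rees argument: the map on the ideal J is first extended by 0 on a high power
    of x, and any extension to R is then automatically x-torsion. *)
Lemma baer_killed (P : E -> Prop) x : baer P ->
  baer (fun e => P e /\ killed_by_power x e).
Proof.
move=> bP r hr r0 rP.
(* The exponent k is such that x^k kills every value of [r]. *)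
have [||k hk] := R_noeth (X := fun k a => exists y, r a y /\ x ^+ k *: y = 0).
- move=> k; split; first by exists 0; rewrite scaler0; split=> //; apply hr.
  move=> c a b [y [ra hy]] [z [rb hz]]; exists (c *: y + z); split.
    by apply hr.
  by rewrite scalerDr hz addr0 scalerA mulrC -scalerA hy scaler0.
- move=> k a [y [ra hy]]; exists y; split=> //; exact: killed_le (leqnSn k) hy.
(* The exponent n is such that the colon ideals J : x^n are stationary from n on. *)
have [||n hn] := R_noeth (X := fun n a => exists y, r (x ^+ n * (a : R)) y).
- move=> n; split; first by exists 0; rewrite mulr0; apply hr.
  move=> c a b [y ra] [z rb]; exists (c *: y + z).
  by rewrite mulrDr -[c *: a]/(c * a) mulrCA; apply hr.
- move=> n a [y ra]; exists (x *: y); rewrite exprS -mulrA.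
  by have [h0 h] := hr; have := h x _ _ _ _ ra h0; rewrite !addr0.
have kx a y : r a y -> x ^+ k *: y = 0.
  move=> ra; have [_ [p hp]] := rP _ _ ra.
  have [|y' [ra' hy']] := hk (maxn k p) a (leq_maxl _ _).
    by exists y; split=> //; exact: killed_le (leq_maxr k p) hp.
  suff -> : y = y' by [].
  apply/eqP; rewrite -subr_eq0; apply/eqP/r0.
  by rewrite -[0](subrr a); exact: lin_relB.
(* The extension by 0 to J + x^(k+n) R. If x^(k+n) t lies in J, so does x^n t, and the value at
   x^(k+n) t is x^k times the value at x^n t, hence 0. *)
pose r' (a : R^o) y := exists b t, a = b + x ^+ (k + n) * t /\ r b y.
have [|y [b [t [bt rb]]]|a y [b [t [_ /rP[]]]]|e [Pe he]] // := bP r'.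
- split; first by exists 0, 0; rewrite mulr0 addr0; split=> //; apply hr.
  move=> c a y a' y' [b [t [-> rb]]] [b' [t' [-> rb']]].
  exists (c * b + b'), (c * t + t'); split; last by apply hr.
  by rewrite scalerDr mulrDr addrACA -[c *: _]/(c * _) -[c *: (_ * _)]/(c * (_ * _)) (mulrCA c).
- have {bt} eb : b = x ^+ (k + n) * - t.
    by apply/eqP; rewrite mulrN -addr_eq0; apply/eqP.
  have [|z rz] := hn (k + n)%N (- t) (leq_addl _ _); first by exists y; rewrite -eb.
  have := kx _ _ rz; suff -> : y = x ^+ k *: z by [].
  apply/eqP; rewrite -subr_eq0; apply/eqP/r0.
  have -> : 0 = b - x ^+ k *: (x ^+ n * - t : R^o).
    by rewrite eb exprD -mulrA subrr.
  apply: (lin_relB hr rb).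
  by have [h0 h] := hr; have := h (x ^+ k) _ _ _ _ rz h0; rewrite !addr0.
exists e; split=> [|a y ra]; last first.
  by apply: he; exists a, 0; rewrite mulr0 addr0.
split=> //; exists (k + n)%N; apply/esym/he.
by exists 0, 1; rewrite mulr1 add0r; split=> //; apply hr.
Qed.

(** Both claims are carried along the list because the division by x has to take place inside the
    torsion for the tail. *)
Lemma baer_acyc xs : baer (fun _ => True) -> acyc xs E /\ baer (tors xs (N := E)).
Proof.
move=> bE; elim: xs => [|x xs [ac bx]] /=.
  split=> // r hr r0 _; have [//|e [_ he]] := bE r hr r0; exists e; split=> // y.
split; first by split=> // n w; apply: baer_divide => //; exact: tors_is_sub.
move=> r hr r0 rP; have [|e [[te ke] he]] := @baer_killed _ x bx r hr r0.
  move=> a y /rP ty; split; last by apply: ty; rewrite mem_head.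
  by move=> z zxs; apply: ty; rewrite inE zxs orbT.
by exists e; split=> // y; rewrite inE => /orP[/eqP->|/te].
Qed.

End Baer.

Lemma cechH_injective (xs : seq R) i (E : lmodType R) : noeth R^o -> injective_module E -> trivial (cechH xs i.+1 E).
Proof.
by move=> hR /injective_baer bE; apply: cechH_acyc; apply (baer_acyc hR xs bE).
Qed.

End Chains.

(** * Powers of an ideal and torsion for its generators *)

Section IdealPowers.
Variables (R : comNzRingType) (m : submodClosed R^o) (xs : seq R).

Definition generates := (forall x, x \in xs -> (x : R^o) \in m) /\
  forall P : R^o -> Prop, is_sub P -> (forall x, x \in xs -> P x) ->
  forall r, r \in m -> P r.

Hypothesis gen : generates.

Lemma ideal_exp_ind n (P : R -> Prop) :
  (forall a b, P a -> P b -> P (a + b)) -> P 0 ->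
  (forall a b, (a : R^o) \in m -> (b : R^o) \in ideal_exp m n -> P (a * b)) ->
  forall r : R, (r : R^o) \in ideal_exp m n.+1 -> P r.
Proof.
move=> PD P0 PM r /asboolP[p [a [b [am bm ->]]]].
by elim/big_rec: _ => // i y _ Py; apply: PD => //; exact: PM.
Qed.

Lemma ideal_exp_mul n (a b : R) :
  (a : R^o) \in m -> (b : R^o) \in ideal_exp m n -> (a * b : R^o) \in ideal_exp m n.+1.
Proof.
move=> am bn; apply/asboolP; exists 1%N, (fun=> a), (fun=> b).
by split=> //; rewrite big_ord1.
Qed.

Lemma expr_ideal_exp (x : R) n : (x : R^o) \in m -> (x ^+ n : R^o) \in ideal_exp m n.
Proof. by move=> xm; elim: n => // n ih; rewrite exprS; exact: ideal_exp_mul. Qed.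

Lemma sumn_map_lt (ys : seq R) (n n' : R -> nat) x : x \in ys ->
  (n' x < n x)%N -> (forall y, (n' y <= n y)%N) -> (sumn (map n' ys) < sumn (map n ys))%N.
Proof.
move=> + lt_x le_n; have le_sum zs : (sumn (map n' zs) <= sumn (map n zs))%N.
  by elim: zs => //= z zs ih; rewrite leq_add.
elim: ys => //= y ys ih; rewrite inE => /orP[/eqP <-|/ih lt_s].
  by rewrite -addSn leq_add.
by rewrite -addnS leq_add.
Qed.

(** A pigeonhole on monomials, by induction: splitting off a factor x replaces v by x v and lowers
    the exponent at x by one. *)
Lemma ideal_exp_kills (V : lmodType R) N (v : V) (n : R -> nat) :
  (forall x, x \in xs -> x ^+ n x *: v = 0) -> (sumn (map n xs) <= N)%N ->
  forall r : R, (r : R^o) \in ideal_exp m N.+1 -> r *: v = 0.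
Proof.
elim: N v n => [|N ih] v n hn leN; apply: ideal_exp_ind => //.
- by move=> a b; rewrite scalerDl => -> ->; rewrite addr0.
- exact: scale0r.
- move=> a b am _; suff v0 : a *: v = 0 by rewrite mulrC -scalerA v0 scaler0.
  have hP : is_sub (fun a : R^o => (a : R) *: v = 0).
    split=> [|k c d hc hd]; first exact: scale0r.
    by rewrite scalerDl -[k *: c]/(k * c) -scalerA hc hd scaler0 addr0.
  case: gen => _ /(_ _ hP); apply => // x xxs.
  case nx : (n x) => [|p].
    by have := hn x xxs; rewrite nx expr0 scale1r => ->; rewrite scaler0.
  have : (sumn (map (fun=> 0%N) xs) < sumn (map n xs))%N.
    by apply: (sumn_map_lt xxs) => //; rewrite nx.
  by rewrite ltnNge (leq_trans leN).
- by move=> a b; rewrite scalerDl => -> ->; rewrite addr0.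
- exact: scale0r.
- move=> a b am bm.
  have hP : is_sub (fun a : R^o => (a * b : R) *: v = 0).
    split=> [|k c d hc hd]; first by rewrite mul0r scale0r.
    by rewrite mulrDl scalerDl -[k *: c]/(k * c) -mulrA -scalerA hc hd scaler0 addr0.
  case: gen => _ /(_ _ hP); apply => // x xxs.
  case nx : (n x) => [|p].
    by have := hn x xxs; rewrite nx expr0 scale1r => ->; rewrite scaler0.
  rewrite mulrC -scalerA; pose n' y := if y == x then p else n y.
  apply: (ih (x *: v) n') => //.
    move=> y yxs; rewrite /n'; case: eqP => [->|_]; last first.
      by rewrite scalerA mulrC -scalerA hn // scaler0.
    by rewrite scalerA -exprSr -nx hn.
  rewrite -ltnS (leq_trans _ leN) // (@sumn_map_lt _ _ _ x) //.
    by rewrite /n' eqxx nx.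
  by move=> y; rewrite /n'; case: eqP => // ->; rewrite nx.
Qed.

Lemma torsionE (V : lmodType R) (v : V) : v \in torsion m V <-> tors xs v.
Proof.
split=> [/asboolP[n hn] x xxs|hv].
  by exists n; apply/hn/expr_ideal_exp; apply gen.
have ex x : exists n, x \in xs -> x ^+ n *: v = 0.
  by have [/hv[n hn]|] := pselect (x \in xs); [exists n | exists 0%N].
have [n hn] := choice ex.
apply/asboolP; exists (sumn (map n xs)).+1.
exact: (ideal_exp_kills hn).
Qed.

End IdealPowers.

Lemma exists_generates (R : comNzRingType) (m : submodClosed R^o) :
  noetherian R -> exists xs, generates m xs.
Proof.
move=> /(_ m)[n [v hv]]; exists (codom v); split=> [x /codomP[i ->]|P hP hx r].
  apply/hv; exists (fun j => (j == i)%:R).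
  rewrite (bigD1 i) //= eqxx scale1r big1 ?addr0 // => j /negPf ->.
  by rewrite scale0r.
move=> /hv[c ->]; apply: (@big_ind _ P); first by apply hP.
  by move=> y z; exact: is_subD.
by move=> i _; apply: is_subZ => //; apply: hx; exact: codom_f.
Qed.

(** * Comparison with injective resolutions *)

Section Syzygies.
Variable R : comNzRingType.
Implicit Types V W : lmodType R.

Section Def.
Variables (V : lmodType R) (I : injective_resolution V).

(** Index 0 is V itself rather than its image in the resolution, so that dimension shifting starts
    at V. *)
Definition syz j : lmodType R :=
  if j is k.+1 then subm (ker_is_sub (diff I k.+1)) else V.

Definition syz_in j : {linear syz j -> I j} :=
  match j return {linear syz j -> I j} with
  | 0 => res_aug I
  | k.+1 => incl (ker_is_sub (diff I k.+1))
  end.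

Fact syz_out_ex j : exists h : {linear I j -> syz j.+1},
  forall y, syz_in j.+1 (h y) = diff I j y.
Proof.
apply: lift_map; first exact: incl_inj.
by move=> y; apply: incl_onto; rewrite diff_diff.
Qed.

Definition syz_out j := projT1 (cid (syz_out_ex j)).

Lemma syz_outE j y : syz_in j.+1 (syz_out j y) = diff I j y.
Proof. by rewrite /syz_out; case: cid. Qed.

Lemma syz_in_inj j : injective (syz_in j).
Proof. by case: j => [|j]; [exact: res_aug_inj | exact: incl_inj]. Qed.

Lemma syz_in_im j y : diff I j y = 0 <-> exists x, syz_in j x = y.
Proof.
case: j y => [|j] y; last exact: incl_iff.
by rewrite res_aug_exact; split=> [[x _ <-]|[x <-]]; exists x.
Qed.

Lemma syz_ses j : ses (syz_in j) (syz_out j).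
Proof.
split; first exact: syz_in_inj.
- move=> y; rewrite -syz_in_im -syz_outE; split=> [->|h]; first by rewrite linear0.
  by apply: (@syz_in_inj j.+1); rewrite h linear0.
- move=> z; have /res_exact[y _ dy] : diff I j.+1 (syz_in j.+1 z) = 0.
    by apply/syz_in_im; exists z.
  by exists y; apply: (@syz_in_inj j.+1); rewrite syz_outE.
Qed.

Variables (xs : seq R) (R_noeth : noeth R^o).

Lemma cechH_res j i : trivial (cechH xs i.+1 (I j)).
Proof. by apply: cechH_injective => //; exact: res_injective. Qed.

Definition syz_delta j i : {linear cechH xs i (syz j.+1) -> cechH xs i.+1 (syz j)} :=
  delta (cech_ses xs (syz_ses j)) i.

Lemma syz_delta_onto j i u : exists v, syz_delta j i v = u.
Proof. by apply/les_next; exact: cechH_res. Qed.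

Lemma syz_delta_inj j i u : syz_delta j i.+1 u = 0 -> u = 0.
Proof. by move=> /les_delta[v <-]; rewrite (cechH_res v) linear0. Qed.

(** The connecting maps are onto by acyclicity of the terms of I, but injective only from positive
    degrees; so the shift ends in degree at least 1. *)
Lemma cechH_syz_shift k i : trivial (cechH xs (i + k).+1 V) <-> trivial (cechH xs i.+1 (syz k)).
Proof.
elim: k i => [|k ih] i; first by rewrite addn0.
rewrite addnS -addSn ih; split=> h u.
  by apply: syz_delta_inj; exact: h.
by have [v <-] := syz_delta_onto u; rewrite (h v) linear0.
Qed.

Section Torsion.
Variable m : submodClosed R^o.
Hypothesis gen : generates m xs.

(** A cocycle of the torsion complex in degree d is a torsion element of the d-th syzygy; this
    records the element [v] representing [u]. *)
Definition lc_rep d (u : cohomology (Gamma_complex m I) d) (v : syz d) :=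
  exists x : Gamma m (I d), rep u x /\ val x = syz_in d v.

Lemma lc_rep_ex d u : exists v, tors xs v /\ @lc_rep d u v.
Proof.
have [x ux] := rep_ex u; have dx := rep_cocycle ux.
have /syz_in_im[v hv] : diff I d (val x) = 0 by have := congr1 val dx.
exists v; split; last by exists x.
move=> y yxs; have /(torsionE gen)/(_ y yxs)[n hn] := valP x.
by exists n; apply: (@syz_in_inj d); rewrite linZ hv hn linear0.
Qed.

Lemma lc_ex_rep d v : tors xs v -> exists u, @lc_rep d u v.
Proof.
move=> tv; have xT : syz_in d v \in torsion m (I d).
  by apply/(torsionE gen); exact: tors_map.
have [|u ux] := @cocycle_rep _ (Gamma_complex m I) d (Sub (syz_in d v) xT).
  by apply: val_inj; rewrite /=; apply/syz_in_im; exists v.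
by exists u, (Sub (syz_in d v) xT).
Qed.

Lemma lc_rep_eq0 d u v : @lc_rep d u v -> (u = 0 <->
  match d return syz d -> Prop with
  | 0 => fun v => v = 0
  | k.+1 => fun v => exists2 t, tors xs t & syz_out k t = v
  end v).
Proof.
move=> [x [ux xv]]; rewrite (rep_eq0 ux).
case: d u v x ux xv => [|k] u v x ux xv; split.
- move=> [w /= hw]; apply: (@syz_in_inj 0); rewrite linear0 -xv -hw.
  by [].
- move=> v0; exists 0; rewrite linear0; apply: val_inj.
  by rewrite /= xv v0 linear0.
- move=> [w /= hw]; exists (val w); first exact/(torsionE gen)/(valP w).
  by apply: (@syz_in_inj k.+1); rewrite syz_outE -xv -hw.
- move=> [t /(torsionE gen) tt ht]; exists (Sub t tt : Gamma m (I k)).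
  by apply: val_inj; rewrite /= xv -ht syz_outE.
Qed.

Lemma lc_repB d u v u' v' : @lc_rep d u v -> @lc_rep d u' v' -> lc_rep (u - u') (v - v').
Proof.
move=> [x [ux xv]] [x' [ux' xv']]; exists (x - x'); split.
  by apply: lin_relB ux ux'; apply rep_lin.
by rewrite [in RHS]linB -xv -xv'; exact: linearB.
Qed.


(** In degree 0 both modules are the torsion of V. In degree k + 1 both are the torsion of syzygy k
    + 1 modulo the image of the torsion of the k-th term of I. *)
Lemma lc_trivial d : trivial (cechH xs d V) <-> trivial (cohomology (Gamma_complex m I) d).
Proof.
case: d => [|k].
  have [h [hinj _ him]] := cechH0_incl xs V; split=> [hV u|hL w].
    have [v [tv uv]] := lc_rep_ex u; apply/(lc_rep_eq0 uv).
    by have [w <-] := (him v).1 tv; rewrite (hV w) linear0.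
  have tw : tors xs (h w) by apply/him; exists w.
  have [u uw] := lc_ex_rep (d := 0) tw.
  by apply: hinj; rewrite linear0; apply/(lc_rep_eq0 uw); exact: hL.
rewrite -[k]add0n cechH_syz_shift add0n.
have [h [hinj hrep him]] := cechH0_incl xs (syz k.+1).
have [g [ginj grep gim]] := cechH0_incl xs (I k).
have hg t : h (cechH_map xs 0 (syz_out k) t) = syz_out k (g t).
  have [z tz] := rep_ex t.
  by rewrite (grep _ _ tz) (hrep _ _ (rep_map (cech_map xs (syz_out k)) tz)) e0_nat.
split=> [hV u|hL w].
  have [v [tv uv]] := lc_rep_ex u; apply/(lc_rep_eq0 uv).
  have [w <-] := (him v).1 tv.
  have /les_delta[t <-] : syz_delta k 0 w = 0 by exact: hV.
  by exists (g t); [apply/gim; exists t | rewrite -hg].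
have [{}w <-] := syz_delta_onto w; apply/les_delta.
have tw : tors xs (h w) by apply/him; exists w.
have [u uw] := lc_ex_rep (d := k.+1) tw.
have /(lc_rep_eq0 uw)[t /gim[t' <-] ht] := hL u.
by exists t'; apply: hinj; rewrite -ht -hg.
Qed.

End Torsion.

End Def.

Section Lift.
Variables (V W : lmodType R) (f : {linear V -> W}).
Variables (I : injective_resolution V) (J : injective_resolution W).
Variable phi : resolution_lift f I J.

Fact syz_map_ex j : exists h : {linear syz I j -> syz J j},
  forall v, syz_in J j (h v) = phi j (syz_in I j v).
Proof.
case: j => [|j]; first by exists f => v; rewrite /= lift_aug.
apply: (@lift_map _ _ _ _ (syz_in J j.+1) (compl (syz_in I j.+1) (phi j.+1))).
  exact: syz_in_inj.
move=> v; apply/syz_in_im; rewrite -chain_mapP.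
suff -> : diff I j.+1 (syz_in I j.+1 v) = 0 by rewrite linear0.
by apply/syz_in_im; exists v.
Qed.

Definition syz_map j := projT1 (cid (syz_map_ex j)).

Lemma syz_mapE j v : syz_in J j (syz_map j v) = phi j (syz_in I j v).
Proof. by rewrite /syz_map; case: cid. Qed.

Lemma syz_map_out j y : syz_map j.+1 (syz_out I j y) = syz_out J j (phi j y).
Proof.
by apply: (@syz_in_inj _ J j.+1); rewrite syz_mapE !syz_outE chain_mapP.
Qed.

Lemma syz_map0 v : syz_map 0 v = f v.
Proof. by apply: (@syz_in_inj _ J 0); rewrite syz_mapE /= lift_aug. Qed.

Variables (xs : seq R) (R_noeth : noeth R^o).

Definition onto (A B : lmodType R) (g : {linear A -> B}) := forall y, exists x, g x = y.

Lemma syz_delta_nat j i u :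
  syz_delta J xs j i (cechH_map xs i (syz_map j.+1) u) =
  cechH_map xs i.+1 (syz_map j) (syz_delta I xs j i u).
Proof.
apply: (@delta_nat _ _ _ _ _ _ _ _ _ _ _ _ _ (cech_map xs (syz_map j))
  (cech_map xs (phi j)) (cech_map xs (syz_map j.+1))) => k z.
  by apply: cech_map_square => a; rewrite syz_mapE.
by apply: cech_map_square => a; rewrite syz_map_out.
Qed.

Lemma syz_onto_shift k i : onto (cechH_map xs (i + k).+1 f) -> onto (cechH_map xs i.+1 (syz_map k)).
Proof.
elim: k i => [|k ih] i.
  rewrite addn0 => h w; have [u <-] := h w; exists u.
  by apply: cechH_map_ext => v; rewrite syz_map0.
rewrite addnS -addSn => /ih h w.
have [u hu] := h (syz_delta J xs k i.+1 w).
have [v hv] := syz_delta_onto (I := I) R_noeth u; exists v.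
apply/eqP; rewrite -subr_eq0; apply/eqP/(syz_delta_inj R_noeth).
by rewrite linearB /= syz_delta_nat hv hu subrr.
Qed.

Variable m : submodClosed R^o.
Hypothesis gen : generates m xs.

Lemma lc_rep_map d u v : lc_rep u v ->
  lc_rep (cohomology_map (Gamma_chain_map m phi) d u) (syz_map d v).
Proof.
move=> [x [ux xv]]; exists (Gamma_map m (phi d) x); split; first exact: rep_map.
by rewrite syz_mapE -xv.
Qed.

Lemma lc_onto d : onto (cechH_map xs d f) ->
  onto (cohomology_map (Gamma_chain_map m phi) d).
Proof.
case: d => [|k] hf y.
  have [v [tv yv]] := lc_rep_ex gen y.
  have [h [hinj hrep him]] := cechH0_incl xs V.
  have [g [ginj grep gim]] := cechH0_incl xs W.
  have [w hw] := (gim v).1 tv; have [u hu] := hf w.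
  have [z uz] := rep_ex u.
  have fhu : f (h u) = v.
    rewrite (hrep _ _ uz) -e0_nat -(grep _ _ (rep_map (cech_map xs f) uz)).
    by rewrite [cohomology_map _ _ _]hu.
  have tu : tors xs (h u) by apply/him; exists u.
  have [x xv] := lc_ex_rep (I := I) gen (d := 0) tu; exists x.
  apply/eqP; rewrite -subr_eq0; apply/eqP.
  apply/(lc_rep_eq0 gen (lc_repB (lc_rep_map xv) yv)).
  by rewrite syz_map0 fhu subrr.
rewrite -[k]add0n in hf; have {}hf := syz_onto_shift hf.
have [v [tv yv]] := lc_rep_ex gen y.
have [h [hinj hrep him]] := cechH0_incl xs (syz I k.+1).
have [g [ginj grep gim]] := cechH0_incl xs (syz J k.+1).
have [q [qinj qrep qim]] := cechH0_incl xs (J k).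
have [w hw] := (gim v).1 tv.
have [u' hu'] := hf (syz_delta J xs k 0 w).
have [u hu] := syz_delta_onto (I := I) R_noeth u'.
(* The lift [u] hits [w] only after the connecting map; the difference comes from torsion of the
   k-th term of J, hence dies in local cohomology. *)
have /les_delta[t ht] : syz_delta J xs k 0 (cechH_map xs 0 (syz_map k.+1) u - w) = 0.
  by rewrite linearB /= syz_delta_nat hu hu' subrr.
have tu : tors xs (h u) by apply/him; exists u.
have [x xv] := lc_ex_rep (I := I) gen (d := k.+1) tu; exists x.
apply/eqP; rewrite -subr_eq0; apply/eqP.
apply/(lc_rep_eq0 gen (lc_repB (lc_rep_map xv) yv)).
exists (q t); first by apply/qim; exists t.
have [z tz] := rep_ex t; have [z' uz] := rep_ex u.
rewrite (qrep _ _ tz) -e0_nat -(grep _ _ (rep_map (cech_map xs _) tz)).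
rewrite [cohomology_map _ _ _]ht linearB /= hw; congr (_ - _).
by rewrite (hrep _ _ uz) -e0_nat -(grep _ _ (rep_map (cech_map xs _) uz)).
Qed.

End Lift.

End Syzygies.

(** * Subquotients and artinian modules *)

Section Subquotients.
Variable R : comNzRingType.
Implicit Types V W Y A B C N : lmodType R.

(** Y is a quotient of a submodule of W, encoded by the graph of the quotient map; composing graphs
    gives transitivity. *)
Definition subquo W Y := exists r : W -> Y -> Prop,
  [/\ lin_rel r, forall y, r 0 y -> y = 0 & forall y, exists w, r w y].

Lemma subquo_inj V W (f : {linear V -> W}) : injective f -> subquo W V.
Proof.
move=> finj; exists (fun w v => f v = w); split.
- split; first exact: linear0.
  by move=> k x y x' y' <- <-; rewrite linearP.
- by move=> y fy; apply: finj; rewrite fy linear0.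
- by move=> y; exists (f y).
Qed.

Lemma subquo_onto V W (g : {linear V -> W}) : (forall w, exists v, g v = w) -> subquo V W.
Proof.
move=> gon; exists (fun v w => g v = w); split=> //.
- split; first exact: linear0.
  by move=> k x y x' y' <- <-; rewrite linearP.
- by move=> y <-; rewrite linear0.
Qed.

Lemma subquo_refl V : subquo V V.
Proof.
exists (fun v w => v = w); split=> //; last by move=> v; exists v.
by split=> // k x y x' y' -> ->.
Qed.

Lemma subquo_trans V W Y : subquo V W -> subquo W Y -> subquo V Y.
Proof.
move=> [r [rl r0 ron]] [s [sl s0 son]].
exists (fun v y => exists2 w, r v w & s w y); split.
- split; first by exists 0; [apply rl | apply sl].
  move=> k v y v' y' [w rw sw] [w' rw' sw'].
  by exists (k *: w + w'); [apply rl | apply sl].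
- by move=> y [w /r0 ->]; exact: s0.
- by move=> y; have [w sw] := son y; have [v rv] := ron w; exists v, w.
Qed.

Lemma subquo_trivial W Y : subquo W Y -> trivial W -> trivial Y.
Proof. by move=> [r [_ r0 ron]] W0 y; have [w] := ron y; rewrite (W0 w); exact: r0. Qed.

Lemma rel_im_sub W Y (r : W -> Y -> Prop) (P : Y -> Prop) :
  lin_rel r -> is_sub P -> is_sub (fun w => exists2 y, r w y & P y).
Proof.
move=> rl hP; split; first by exists 0; [apply rl | apply hP].
move=> k w w' [y rw Py] [y' rw' Py']; exists (k *: y + y'); first by apply rl.
by apply hP.
Qed.

Lemma rel_fun W Y (r : W -> Y -> Prop) w y y' : lin_rel r ->
  (forall y, r 0 y -> y = 0) -> r w y -> r w y' -> y = y'.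
Proof.
move=> rl r0 h h'; apply/eqP; rewrite -subr_eq0; apply/eqP/r0.
by rewrite -[0](subrr w); exact: lin_relB.
Qed.

Definition dcc V := forall X : nat -> V -> Prop, (forall n, is_sub (X n)) ->
  (forall n v, X n.+1 v -> X n v) ->
  exists n, forall k v, (n <= k)%N -> X n v -> X k v.

Lemma descend V (X : nat -> V -> Prop) n k v :
  (forall n v, X n.+1 v -> X n v) -> (n <= k)%N -> X k v -> X n v.
Proof. by move=> dec /subnK <-; elim: (k - n)%N => //= j ih /dec /ih. Qed.

Lemma noeth_subquo W Y : subquo W Y -> noeth W -> noeth Y.
Proof.
move=> [r [rl r0 ron]] hW X hX inc.
have [||n hn] := hW (fun n w => exists2 y, r w y & X n y).
- by move=> n; exact: rel_im_sub.
- by move=> n w [y ry /inc Xy]; exists y.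
exists n => k y nk Xy; have [w rw] := ron y.
have [|y' rw' Xy'] := hn k w nk; first by exists y.
by rewrite (rel_fun rl r0 rw rw').
Qed.

Lemma dcc_subquo W Y : subquo W Y -> dcc W -> dcc Y.
Proof.
move=> [r [rl r0 ron]] hW X hX dec.
have [||n hn] := hW (fun n w => exists2 y, r w y & X n y).
- by move=> n; exact: rel_im_sub.
- by move=> n w [y ry /dec Xy]; exists y.
exists n => k y nk Xy; have [w rw] := ron y.
have [|y' rw' Xy'] := hn k w nk; first by exists y.
by rewrite (rel_fun rl r0 rw rw').
Qed.

Section Middle.
Variables (A B C : lmodType R) (f : {linear A -> B}) (g : {linear B -> C}).
Hypothesis ex : forall b, g b = 0 -> exists a, f a = b.

Lemma noeth_mid : noeth A -> noeth C -> noeth B.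
Proof.
move=> hA hC X hX inc.
have [||n hn] := hA (fun n a => X n (f a)).
- by move=> n; exact: preim_is_sub.
- by move=> n a; exact: inc.
have [||p hp] := hC (fun n c => exists2 b, X n b & g b = c).
- by move=> p; exact: im_sub_is_sub.
- by move=> p c [b /inc Xb gb]; exists b.
exists (maxn n p) => k b; rewrite geq_max => /andP[nk pk] Xb.
have [|b' Xb' gb'] := hp k (g b) pk; first by exists b.
have [|a fa] := ex (b := b - b'); first by rewrite linearB /= gb' subrr.
rewrite -(subrK b' b) -fa; apply: is_subD => //; last first.
  exact: ascend (leq_maxr n p) Xb'.
apply: ascend (leq_maxl n p) _ => //; apply: (hn k) => //; rewrite fa.
by apply: is_subB => //; exact: ascend pk Xb'.
Qed.

Lemma dcc_mid : dcc A -> dcc C -> dcc B.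
Proof.
move=> hA hC X hX dec.
have [||n hn] := hA (fun n a => X n (f a)).
- by move=> n; exact: preim_is_sub.
- by move=> n a; exact: dec.
have [||p hp] := hC (fun n c => exists2 b, X n b & g b = c).
- by move=> p; exact: im_sub_is_sub.
- by move=> p c [b /dec Xb gb]; exists b.
exists (maxn n p) => k b; rewrite geq_max => /andP[nk pk] Xb.
have [|b' Xb' gb'] := hp k (g b) pk.
  by exists b => //; exact: descend (leq_maxr n p) Xb.
have [|a fa] := ex (b := b - b'); first by rewrite linearB /= gb' subrr.
rewrite -(subrK b' b) -fa; apply: is_subD => //.
apply: hn => //; rewrite fa; apply: is_subB => //.
  exact: descend (leq_maxl n p) Xb.
exact: descend nk Xb'.
Qed.

End Middle.

Lemma noeth_inj V W (f : {linear V -> W}) : injective f -> noeth W -> noeth V.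
Proof. by move=> /subquo_inj; exact: noeth_subquo. Qed.

Lemma noeth_onto V W (g : {linear V -> W}) :
  (forall w, exists v, g v = w) -> noeth V -> noeth W.
Proof. by move=> /subquo_onto; exact: noeth_subquo. Qed.

Lemma trivial_noeth V : trivial V -> noeth V.
Proof. by move=> hV X hX _; exists 0%N => k v _ _; rewrite (hV v); apply hX. Qed.

Lemma noeth_max V (F : (V -> Prop) -> Prop) : noeth V ->
  (forall P, F P -> is_sub P) -> (exists P, F P) ->
  exists P, F P /\ forall Q, F Q -> (forall v, P v -> Q v) -> forall v, Q v -> P v.
Proof.
move=> hV Fsub [P0 FP0]; apply: contrapT => nmax.
have step (S : {P | F P}) : exists S' : {P | F P},
    (forall v, sval S v -> sval S' v) /\ exists2 v, sval S' v & ~ sval S v.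
  apply: contrapT => nS; apply: nmax; exists (sval S); split; first exact: svalP.
  move=> Q FQ PQ v Qv; apply: contrapT => nv; apply: nS.
  by exists (exist _ Q FQ); split=> //; exists v.
have [next hnext] := choice step.
pose S := fix S n := if n is k.+1 then next (S k) else exist _ P0 FP0.
have [||n hn] := hV (fun n => sval (S n)).
- by move=> n; apply: Fsub; exact: svalP.
- by move=> n v; apply (hnext (S n)).
have [v Sv []] := (hnext (S n)).2.
exact: (hn n.+1).
Qed.

Lemma noeth_bounded V x : noeth V -> (forall v : V, killed_by_power x v) ->
  exists n, forall v : V, x ^+ n *: v = 0.
Proof.
move=> hV hx; have [||n hn] := hV (fun n v => x ^+ n *: v = 0).
- by move=> n; exact: (ker_is_sub (mulby V (x ^+ n))).
- by move=> n v; exact: killed_le.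
exists n => v; have [k hk] := hx v.
by apply: (hn (maxn n k)); rewrite ?leq_maxl //; exact: killed_le (leq_maxr n k) hk.
Qed.

Definition kernel W y : lmodType R := subm (ker_is_sub (mulby W y)).

Definition kernel_in W y : {linear kernel W y -> W} := incl (ker_is_sub (mulby W y)).

Lemma kernel_killed W y (v : kernel W y) : y *: kernel_in W y v = 0.
Proof. exact: (inclP v). Qed.

Lemma kernel_onto W y (w : W) : y *: w = 0 -> exists v, kernel_in W y v = w.
Proof. exact: incl_onto. Qed.

(* Melkersson's criterion, by the dual of the proof of Hilbert's basis theorem. *)
Lemma dcc_of_kernel W y : (forall w : W, killed_by_power y w) ->
  dcc (kernel W y) -> dcc W.
Proof.
move=> ky hU X hX dec.
(* The analogue of leading coefficients: elements of ker y of the form y^j x with x in [X i]. They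
   decrease in both i and j. *)
pose Y i j e := exists2 x, X i x & kernel_in W y e = y ^+ j *: x.
have Ysub i j : is_sub (Y i j).
  split; first by exists 0; [apply hX | rewrite linear0 scaler0].
  move=> k e e' [x Xx ex] [x' Xx' ex']; exists (k *: x + x'); first by apply hX.
  by rewrite linearP ex ex' scalerDr !scalerA mulrC.
have Ydeci i i' j e : (i <= i')%N -> Y i' j e -> Y i j e.
  by move=> ii' [x Xx ex]; exists x => //; exact: descend ii' Xx.
have Ydecj i j j' e : (j <= j')%N -> Y i j' e -> Y i j e.
  move=> /subnKC <- [x Xx ex]; exists (y ^+ (j' - j) *: x); first exact: is_subZ.
  by rewrite -scalerX_exp.
have [||n0 hn0] := hU (fun n => Y n n) => //.
  by move=> n e /(Ydeci n) h; apply: Ydecj (leqnSn n) _; apply: h.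
have /choice[s hs] j : exists s, forall k e, (s <= k)%N -> Y s j e -> Y k j e.
  by apply: hU => // n e; exact: Ydeci.
(* The diagonal is stationary from n0 on, which settles the rows j ≥ n0; the finitely many remaining
   rows have their own bounds. *)
pose q := maxn n0 (\max_(j < n0) s j).
have stab i j e : (q <= i)%N -> Y q j e -> Y i j e.
  rewrite geq_max => /andP[ni si] Ye.
  have [jn0|n0j] := ltnP j n0.
    have sj : (s j <= \max_(j < n0) s j)%N by exact: (leq_bigmax (Ordinal jn0)).
    apply: hs; first exact: leq_trans sj si.
    by apply: Ydeci Ye; rewrite leq_max sj orbT.
  have Y0 : Y n0 n0 e by apply: Ydeci (Ydecj _ _ _ _ n0j Ye); rewrite leq_maxl.
  have := hn0 (maxn i j) e; rewrite leq_max ni => /(_ isT Y0).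
  move=> h; apply: Ydecj (leq_maxr i j) _; exact: Ydeci (leq_maxl i j) h.
exists q => i v qi Xv; have [t ht] := ky v.
elim: t v Xv ht => [|t ih] v Xv; first by rewrite expr0 scale1r => ->; apply hX.
rewrite exprS -scalerA => /kernel_onto[e he].
(* Some x in [X i] has the same multiple by y^t as v, so v - x is killed by y^t and the induction on
   t applies. *)
have [|x Xx ex] := stab i t e qi; first by exists v.
rewrite -(subrK x v); apply: is_subD => //; apply: ih.
  by apply: is_subB => //; exact: descend qi Xx.
by rewrite scalerBr -he ex subrr.
Qed.

End Subquotients.

(** * Artinian torsion modules and dévissage by torsion *)

Section LocalRing.
Variables (R : comNzRingType) (m : submodClosed R^o) (xs : seq R).
Hypotheses (R_noeth : noeth R^o) (m_local : local_ring m) (gen : generates m xs).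
Implicit Types V W Y A B C N : lmodType R.

Lemma unit_mod_max (r : R) : (r : R^o) \notin m -> exists s : R, (1 - s * r : R^o) \in m.
Proof.
move=> rm; have hI : is_sub (fun a : R^o => exists s : R, (a - s * r : R^o) \in m).
  split; first by exists 0; rewrite mul0r subr0 rpred0.
  move=> k a b [s as_] [t bt]; exists (k * s + t).
  have -> : k *: a + b - (k * s + t) * r = k *: (a - s * r : R^o) + (b - t * r).
    by rewrite scalerBr -[k *: (_ * _)]/(k * (_ * _)) mulrA mulrDl opprD addrACA.
  by rewrite rpredD ?rpredZ.
case: m_local => -[m1 mmax] _.
have [I1|I1] := boolP ((1 : R^o) \in sub_of hI); first exact/(sub_ofP hI).
case/negP: rm; apply: (mmax (sub_of hI)) => //.
  by move=> a am; apply/sub_ofP; exists 0; rewrite mul0r subr0.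
by apply/sub_ofP; exists 1; rewrite mul1r subrr rpred0.
Qed.

Lemma killed_by_max V (v : V) : (forall x, x \in xs -> x *: v = 0) ->
  forall r : R, (r : R^o) \in m -> r *: v = 0.
Proof.
move=> hv; have hP : is_sub (fun a : R^o => (a : R) *: v = 0).
  split=> [|k c d hc hd]; first exact: scale0r.
  by rewrite scalerDl -[k *: c]/(k * c) -scalerA hc hd scaler0 addr0.
by case: gen => _ /(_ _ hP); apply.
Qed.

(** Such a V is a vector space over R/m. Take Q maximal among the submodules meeting some [X n]
    trivially. If v lay in [X n] but not in a later [X k], then Q + R v would meet [X k] trivially,
    so v would lie in Q and vanish. *)
Lemma dcc_killed V : noeth V -> (forall (v : V) x, x \in xs -> x *: v = 0) -> dcc V.
Proof.
move=> hV kV X hX dec.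
have km (v : V) (r : R) : (r : R^o) \in m -> r *: v = 0.
  by apply: killed_by_max => x; exact: kV.
have [| |Q [[hQ [n Qn]] Qmax]] := @noeth_max _ V
    (fun Q => is_sub Q /\ exists n, forall v, Q v -> X n v -> v = 0) hV.
- by move=> P [].
- exists (fun v => v = 0); split; last by exists 0%N.
  by split=> // k v w -> ->; rewrite scaler0 addr0.
exists n => k v nk Xnv; apply: contrapT => Xkv.
pose Q' w := exists q (r : R), Q q /\ w = q + r *: v.
have Q'sub : is_sub Q'.
  split; first by exists 0, 0; rewrite scale0r addr0; split=> //; apply hQ.
  move=> c w w' [q [r [Qq ->]]] [q' [r' [Qq' ->]]].
  exists (c *: q + q'), (c * r + r'); split; first by apply hQ.
  by rewrite scalerDr scalerDl addrACA scalerA.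
have Q'k w : Q' w -> X k w -> w = 0.
  move=> [q [r [Qq ->]]] Xw.
  have q0 : q = 0.
    apply: Qn => //; rewrite -[q](addrK (r *: v)).
    by apply: is_subB => //; [exact: descend nk Xw | exact: is_subZ].
  move: Xw; rewrite q0 add0r => Xrv.
  have [rm|/unit_mod_max[s sm]] := boolP ((r : R^o) \in m); first exact: km.
  have := km v _ sm; rewrite scalerBl scale1r => /eqP; rewrite subr_eq0 => /eqP vE.
  by case: Xkv; rewrite vE -scalerA; exact: is_subZ.
have Qv : Q v.
  apply: (Qmax Q'); first by split=> //; exists k.
    by move=> w Qw; exists w, 0; rewrite scale0r addr0.
  by exists 0, 1; rewrite scale1r add0r; split=> //; apply hQ.
by case: Xkv; rewrite (Qn v) //; apply hX.
Qed.

(** Melkersson's criterion, applied to one generator after another, reduces the claim to submodules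
    killed by all generators. *)
Lemma dcc_tors V : noeth V -> (forall v : V, tors xs v) -> dcc V.
Proof.
move=> hV tV; suff dcc_list ys W : (forall w : W, tors ys w) ->
    (forall (U : lmodType R) (i : {linear U -> W}), injective i ->
       (forall (u : U) x, x \in ys -> x *: u = 0) -> dcc U) -> dcc W.
  apply: (dcc_list xs V tV) => U i iinj kU; apply: dcc_killed => //.
  exact: noeth_inj iinj hV.
elim: ys W => [|y ys ih] W tW hW.
  by apply: (hW W (lin (f := id) (fun k x y => erefl))) => // u u1.
apply: (@dcc_of_kernel _ W y) => [w|]; first by apply: tW; rewrite mem_head.
apply: ih => [w x xys|U i iinj kU].
  have [|n hn] := tW (kernel_in W y w) x; first by rewrite inE xys orbT.
  by exists n; apply: (@incl_inj _ _ _ (ker_is_sub (mulby W y))); rewrite linZ hn linear0.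
apply: (hW U (compl i (kernel_in W y))).
  by move=> u v; rewrite !linE => /incl_inj /iinj.
move=> u x; rewrite inE => /orP[/eqP->|]; last exact: kU.
apply: iinj; apply: (@incl_inj _ _ _ (ker_is_sub (mulby W y))).
by rewrite !linZ kernel_killed !linear0.
Qed.

(** Every N is an extension of N / (y-torsion), on which y is regular, by its y-torsion. Treating
    the generators y in turn leaves a module that is torsion for all of them. *)
Lemma devissage (P : lmodType R -> Prop) :
  (forall N, noeth N -> (forall v : N, tors xs v) -> P N) ->
  (forall A B C (f : {linear A -> B}) (g : {linear B -> C}),
     ses f g -> noeth B -> P A -> P C -> P B) ->
  (forall N y, noeth N -> y \in xs -> (forall v : N, y *: v = 0 -> v = 0) -> P N) ->
  forall N, noeth N -> P N.
Proof.
move=> Ptors Pses Preg.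
suff dev (ys : seq R) N : {subset ys <= xs} -> noeth N ->
    (forall x, x \in xs -> x \in ys \/ forall v : N, killed_by_power x v) -> P N.
  by move=> N hN; apply: (dev xs N _ hN) => x; [|left].
elim: ys N => [|y ys ih] N sub hN tN.
  by apply: Ptors => // v x /tN[//|]; exact.
have S := ses_sub (killed_is_sub y N); have [inj _ on] := S.
apply: (Pses _ _ _ _ _ S hN).
  apply: ih; first by move=> x xys; apply: sub; rewrite inE xys orbT.
    exact: noeth_inj inj hN.
  have transfer x : (forall v : N, killed_by_power x v) ->
      forall v : subm (killed_is_sub y N), killed_by_power x v.
    by move=> h v; have [n hn] := h (incl _ v); exists n; apply: inj; rewrite linZ hn linear0.
  move=> x /tN[|/transfer]; last by right.
  rewrite inE => /orP[/eqP->|]; last by left.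
  right=> v; have [n hn] := inclP v.
  by exists n; apply: inj; rewrite linZ hn linear0.
apply: (Preg _ y); [exact: noeth_onto on hN | by apply: sub; rewrite mem_head |].
move=> v; have [w <-] := on v; rewrite -linZ !proj_eq0 => -[n hn].
by exists n.+1; rewrite exprSr -scalerA.
Qed.

End LocalRing.

(** * Primes and dimension *)

Section Dimension.
Variable R : comNzRingType.
Hypothesis R_noeth : noeth R^o.
Implicit Types V W Y A B C N : lmodType R.

(** An ideal Q maximal among those containing J and missing S is prime: if x and y lay outside, Q +
    (x) and Q + (y) would meet S, and hence so would Q + (x y). *)
Lemma prime_avoiding (J : R^o -> Prop) (S : R -> Prop) : is_sub J -> S 1 ->
  (forall s t, S s -> S t -> S (s * t)) -> (forall s, S s -> ~ J s) ->
  exists q : submodClosed R^o, [/\ prime_ideal q, forall r, J r -> r \in q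
    & forall s, S s -> (s : R^o) \notin q].
Proof.
move=> hJ S1 SM SJ.
have [| |Q [[hQ [JQ SQ]] Qmax]] := @noeth_max _ R^o
    (fun Q => is_sub Q /\ (forall r, J r -> Q r) /\ forall s, S s -> ~ Q s) R_noeth.
- by move=> P [].
- by exists J.
have meets (x : R) : ~ Q x -> exists s a : R, [/\ S s, Q a & exists b, s = a + b * x].
  move=> nx; apply: contrapT => nmeets; apply: nx.
  pose Q' (w : R^o) := exists a b : R, Q a /\ w = a + b * x.
  apply: (Qmax Q'); last by exists 0, 1; rewrite mul1r add0r; split=> //; apply hQ.
    split.
      split; first by exists 0, 0; rewrite mul0r addr0; split=> //; apply hQ.
      move=> c w w' [a [b [Qa ->]]] [a' [b' [Qa' ->]]].
      exists (c * a + a'), (c * b + b'); split; first by apply hQ.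
      by rewrite scalerDr mulrDl addrACA -[c *: _]/(c * a) -[c *: _]/(c * (b * x)) mulrA.
    split=> [r /JQ Qr|s Ss [a [b [Qa sE]]]].
      by exists r, 0; rewrite mul0r addr0.
    by apply: nmeets; exists s, a; split=> //; exists b.
  by move=> w Qw; exists w, 0; rewrite mul0r addr0.
exists (sub_of hQ); split.
- split; first by apply/negP => /(sub_ofP hQ); exact: SQ.
  move=> x y /(sub_ofP hQ) Qxy; apply: contrapT => /not_orP[nx ny].
  have [|s [a [Ss Qa [b sE]]]] := meets x; first by move=> Qx; apply: nx; exact/(sub_ofP hQ).
  have [|t [c [St Qc [d tE]]]] := meets y; first by move=> Qy; apply: ny; exact/(sub_ofP hQ).
  case: (SQ _ (SM _ _ Ss St)).
  have -> : s * t = s *: (c : R^o) + ((d * y) *: (a : R^o) + (b * d) *: (x * y : R^o)).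
    by rewrite -[RHS]/(s * c + (d * y * a + b * d * (x * y))) tE sE; ring.
  by do 2?[apply: is_subD => //]; exact: is_subZ.
- by move=> r /JQ Qr; exact/(sub_ofP hQ).
- by move=> s Ss; apply/negP => /(sub_ofP hQ); exact: SQ.
Qed.

Lemma ann_is_sub N : is_sub (fun r : R^o => annihilates N r).
Proof.
split=> [v|k r s hr hs v]; first exact: scale0r.
by rewrite scalerDl hs addr0 -[k *: r]/(k * r) -scalerA hr scaler0.
Qed.

Lemma ann_inj A N (f : {linear A -> N}) : injective f ->
  forall r, annihilates N r -> annihilates A r.
Proof. by move=> finj r hr a; apply: finj; rewrite linZ hr linear0. Qed.

Lemma ann_onto N C (g : {linear N -> C}) : (forall c, exists v, g v = c) ->
  forall r, annihilates N r -> annihilates C r.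
Proof. by move=> gon r hr c; have [v <-] := gon c; rewrite -linZ hr linear0. Qed.

(** This is dim N < c, as longer chains can be truncated; c = 0 expresses dimension -∞. *)
Definition dimlt N c := ~ exists p, prime_chain N c p.

Definition chain_cons (q : submodClosed R^o) (p : nat -> submodClosed R^o) i :=
  if i is j.+1 then p j else q.

Lemma chain_consP N N' k q (p : nat -> submodClosed R^o) : prime_ideal q ->
  (forall r, annihilates N r -> (r : R^o) \in q) -> {subset q <= p 0%N} ->
  ~ {subset p 0%N <= q} -> (forall r, annihilates N r -> annihilates N' r) ->
  prime_chain N' k p -> prime_chain N k.+1 (chain_cons q p).
Proof.
move=> pq Nq qp pnq NN' [p1 p2 p3]; split.
- by case=> // i /p1.
- by case=> [|i] r; [move=> _; exact: Nq | move=> ik /NN'; exact: p2].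
- by case=> //= i; exact: p3.
Qed.

Lemma chain_behead N N' k (p : nat -> submodClosed R^o) : prime_chain N k.+1 p ->
  (forall r, annihilates N' r -> (r : R^o) \in p 1%N) ->
  prime_chain N' k (fun i => p i.+1).
Proof.
move=> [p1 p2 p3] N'p; split.
- by move=> i ik; exact: p1.
- move=> i r ik /N'p; elim: i ik => // i ih ik rp.
  by apply (p3 i.+1 ik); apply: ih => //; exact: ltnW.
- by move=> i ik; exact: (p3 i.+1).
Qed.

Lemma chain_weaken N N' k (p : nat -> submodClosed R^o) : prime_chain N k p ->
  (forall r, annihilates N' r -> (r : R^o) \in p 0%N) -> prime_chain N' k p.
Proof.
move=> [p1 p2 p3] N'p; split=> //.
move=> i r ik /N'p; elim: i ik => // i ih ik rp.
by apply (p3 i ik); apply: ih => //; exact: ltnW.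
Qed.

Lemma dimlt_ann N N' c : (forall r, annihilates N r -> annihilates N' r) ->
  dimlt N c -> dimlt N' c.
Proof.
move=> NN' hN [p hp]; apply: hN; exists p; apply: (chain_weaken hp).
by move=> r /NN'; case: hp => _ h _; exact: h.
Qed.

Lemma dimlt_inj A N (f : {linear A -> N}) c : injective f -> dimlt N c -> dimlt A c.
Proof. by move=> /ann_inj; exact: dimlt_ann. Qed.

Lemma dimlt_onto N C (g : {linear N -> C}) c : (forall c, exists v, g v = c) ->
  dimlt N c -> dimlt C c.
Proof. by move=> /ann_onto; exact: dimlt_ann. Qed.

Lemma dimlt_le N c d : (c <= d)%N -> dimlt N c -> dimlt N d.
Proof.
move=> cd hN [p [p1 p2 p3]]; apply: hN; exists p; split.
- by move=> i ic; apply: p1; exact: leq_trans ic cd.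
- by move=> i r ic; apply: p2; exact: leq_trans ic cd.
- by move=> i ic; apply: p3; exact: leq_trans ic cd.
Qed.

Lemma dimlt0 N : dimlt N 0 -> trivial N.
Proof.
move=> hN; suff h1 : annihilates N 1 by move=> v; have := h1 v; rewrite scale1r.
apply: contrapT => n1; have [|||q [pq Nq _]] := @prime_avoiding _ (fun s => s = 1) (ann_is_sub N).
- by [].
- by move=> s t -> ->; rewrite mulr1.
- by move=> s ->.
by apply: hN; exists (fun=> q); split=> // i r _; exact: Nq.
Qed.

(** A chain for C starts at a prime p_0 containing y. The products s y^n with s outside p_0 miss the
    annihilator of N because y is regular, so some prime over it lies inside p_0 and omits y; it
    extends the chain downwards. *)
Lemma dimlt_regular N C (g : {linear N -> C}) y c : (forall c, exists v, g v = c) ->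
  (forall v : N, y *: v = 0 -> v = 0) -> annihilates C y ->
  dimlt N c.+1 -> dimlt C c.
Proof.
move=> gon yreg yC hN [p hp]; apply: hN; have [p1 p2 p3] := hp.
have [pn1 pmul] := p1 0%N isT.
have [|||q [pq Nq Sq]] := @prime_avoiding _
    (fun t => exists s n, (s : R^o) \notin p 0%N /\ t = s * y ^+ n) (ann_is_sub N).
- by exists 1, 0%N; rewrite mulr1.
- move=> _ _ [s [i [sp ->]]] [t [j [tp ->]]]; exists (s * t), (i + j)%N; split.
    by apply/negP => /pmul[]; apply/negP.
  by rewrite exprD mulrACA.
- move=> _ [s [i [sp ->]]] hs; case/negP: sp; apply: p2 => //.
  apply: (ann_onto gon) => v.
  elim: i v hs => [|i ih] v hs; first by rewrite -(hs v) mulr1.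
  apply: ih => w; apply: yreg; rewrite -(hs w) scalerA exprS.
  by congr (_ *: _); rewrite mulrCA.
exists (chain_cons q p); apply: chain_consP hp => //.
- move=> r rq; apply: contrapT => /negP rp.
  by have /negP := Sq r (ex_intro _ r (ex_intro _ 0%N (conj rp (esym (mulr1 r))))).
- move=> pq0; have /negP := Sq y (ex_intro _ 1 (ex_intro _ 1%N (conj pn1 (esym (mul1r y))))).
  by apply; apply: pq0; exact: p2.
- exact: ann_onto gon.
Qed.

End Dimension.

(** * The cyclic modules R/q *)

Section CyclicModules.
Variables (R : comNzRingType) (q : submodClosed R^o).

Definition cyc : lmodType R := quo (mem_is_sub q).
Definition cyc_proj : {linear R^o -> cyc} := proj (mem_is_sub q).

Lemma cyc_eq0 (r : R) : r *: cyc_proj 1 = 0 <-> (r : R^o) \in q.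
Proof. by rewrite -linZ proj_eq0 -[r *: 1]/(r * 1) mulr1. Qed.

Lemma cyc_gen (v : cyc) : exists r : R, v = r *: cyc_proj 1.
Proof.
have [r <-] := proj_onto v; exists r; rewrite -linZ.
by congr (cyc_proj _); rewrite -[r *: 1]/(r * 1) mulr1.
Qed.

Lemma ann_cyc (r : R) : annihilates cyc r <-> (r : R^o) \in q.
Proof.
split=> [h|rq v]; first exact/cyc_eq0.
have [s ->] := cyc_gen v; rewrite scalerA mulrC -scalerA.
by have /cyc_eq0 -> := rq; rewrite scaler0.
Qed.

Lemma cyc_noeth : noeth R^o -> noeth cyc.
Proof. by apply: noeth_onto; exact: (@proj_onto _ _ _ (mem_is_sub q)). Qed.

Lemma cyc_regular r : prime_ideal q -> (r : R^o) \notin q ->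
  forall v : cyc, r *: v = 0 -> v = 0.
Proof.
move=> [_ qmul] rq v; have [s ->] := cyc_gen v; rewrite scalerA => /cyc_eq0.
by move=> /qmul[h|/cyc_eq0 //]; rewrite h in rq.
Qed.

Lemma chain_cyc_sub (p : nat -> submodClosed R^o) k :
  prime_chain cyc k p -> {subset q <= p 0%N}.
Proof. by move=> [_ h _] r /ann_cyc; exact: h. Qed.

End CyclicModules.

(** * Modules with a finite list of generators *)

Section Generated.
Variable R : comNzRingType.
Hypothesis R_noeth : noeth R^o.
Implicit Types V W Y A B C N : lmodType R.

Definition generated_by N (s : seq N) :=
  forall P : N -> Prop, is_sub P -> (forall v, v \in s -> P v) -> forall v, P v.

Definition line_rel N (x : N) : is_sub (fun v => exists r : R, v = r *: x).
Proof.
split; first by exists 0; rewrite scale0r.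
by move=> k v w [r ->] [s ->]; exists (k * r + s); rewrite scalerDl scalerA.
Qed.

Lemma generated_quo N (x : N) s : generated_by (x :: s) ->
  generated_by [seq proj (line_rel x) v | v <- s].
Proof.
move=> gN P hP hs v; have [w <-] := proj_onto v.
apply: (gN (fun w => P (proj (line_rel x) w))); first exact: preim_is_sub.
move=> u; rewrite inE => /orP[/eqP->|us]; last by apply: hs; exact: map_f.
suff -> : proj (line_rel x) x = 0 by apply hP.
by apply/proj_eq0; exists 1; rewrite scale1r.
Qed.

Lemma generated_noeth N s : @generated_by N s -> noeth N.
Proof.
have [n] := ubnP (size s); elim: n N s => // n ih N [|x s] le_n gN.
  apply: trivial_noeth => v; apply: (gN (fun v => v = 0)) => //.
  by split=> // k u w -> ->; rewrite scaler0 addr0.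
apply: (@noeth_mid _ _ _ _ (incl (line_rel x)) (proj (line_rel x))).
- by move=> b /proj_eq0; exact: incl_onto.
- have ml : linear (fun r : R^o => (r : R) *: x).
    by move=> k r t; rewrite scalerDl -[k *: r]/(k * r) scalerA.
  have [y|h hE] := @lift_map _ _ _ _ (incl (line_rel x)) (lin ml) (@incl_inj _ _ _ (line_rel x)).
    by apply: incl_onto; exists y.
  apply: (noeth_onto (g := h)) R_noeth => w.
  have [r rE] := inclP w; exists r; apply: (@incl_inj _ _ _ (line_rel x)).
  by rewrite hE rE.
- by apply: ih (generated_quo gN); rewrite size_map.
Qed.

(** Let x be the first generator. If p contains the annihilator of N/Rx, induction applies.
    Otherwise some t outside p has t N inside R x, and the annihilator of x lies in p; sending v to
    the class of r, where t v = r x, is then well defined and maps x to t ≠ 0. *)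
Lemma nonzero_map_cyc N s (p : submodClosed R^o) : @generated_by N s ->
  prime_ideal p -> (forall r, annihilates N r -> (r : R^o) \in p) ->
  exists (f : {linear N -> cyc p}) v, f v <> 0.
Proof.
move=> + [p1 pmul]; have [n] := ubnP (size s); elim: n N s => // n ih N [|x s] le_n gN Np.
  case/negP: p1; apply: Np => v; rewrite scale1r; apply: (gN (fun v => v = 0)) => //.
  by split=> // k u w -> ->; rewrite scaler0 addr0.
have [Cp|] := pselect (forall r, annihilates (quo (line_rel x)) r -> (r : R^o) \in p).
  have [|f [v fv]] := ih _ _ _ (generated_quo gN) Cp; first by rewrite size_map.
  have [w wv] := proj_onto v.
  by exists (compl (proj (line_rel x)) f), w; rewrite linE wv.
move=> /existsNP[t /not_implyP[tC tp]].
have tx v : exists r : R, t *: v = r *: x.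
  by have := tC (proj (line_rel x) v); rewrite -linZ => /proj_eq0.
have xp r : r *: x = 0 -> (r : R^o) \in p.
  move=> rx; have /Np/pmul[//|] : annihilates N (r * t); last by move=> ?; case: tp.
  by move=> v; rewrite -scalerA; have [u ->] := tx v; rewrite scalerA mulrC -scalerA rx scaler0.
have [|v|v|f fE] := @lin_rel_map _ N (cyc p)
    (fun v w => exists r : R, t *: v = r *: x /\ w = r *: cyc_proj p 1).
- split; first by exists 0; rewrite !scale0r scaler0.
  move=> k v w v' w' [r [rv ->]] [r' [rv' ->]]; exists (k * r + r').
  rewrite scalerDr rv' [t *: (k *: v)]scalerA mulrC -scalerA rv.
  by rewrite !scalerDl !scalerA.
- by have [r rv] := tx v; exists (r *: cyc_proj p 1), r.
- by move=> [r [/esym]]; rewrite scaler0 => /xp/cyc_eq0 -> ->.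
exists f, x; have /fE <- : exists r : R, t *: x = r *: x /\ t *: cyc_proj p 1 = r *: cyc_proj p 1.
  by exists t.
by move=> /cyc_eq0.
Qed.

End Generated.

(** * Vanishing and smallness *)

Section LocalCohomologyDimension.
Variables (R : comNzRingType) (m : submodClosed R^o) (xs : seq R).
Hypotheses (R_noeth : noeth R^o) (m_local : local_ring m) (gen : generates m xs).
Implicit Types V W Y A B C N : lmodType R.

Lemma cechH_onto A B C (f : {linear A -> B}) (g : {linear B -> C}) i :
  ses f g -> trivial (cechH xs i.+1 A) -> forall u, exists v, cechH_map xs i g v = u.
Proof. by move=> S hA u; apply/(les_delta (cech_ses xs S)); exact: hA. Qed.

Lemma cechH_exact A B C (f : {linear A -> B}) (g : {linear B -> C}) i (u : cechH xs i B) :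
  ses f g -> (cechH_map xs i g u = 0 <-> exists v, cechH_map xs i f v = u).
Proof. by move=> S; exact: (les_mid (cech_ses xs S)). Qed.

Lemma cechH_killed N r i (u : cechH xs i N) : (forall v : N, r *: v = 0) -> r *: u = 0.
Proof.
move=> hr; rewrite -(cechH_map_scale (f := mulby N r) u) //.
by rewrite (cechH_map_scale (x := 0)) ?scale0r // => v; rewrite mulbyE hr scale0r.
Qed.

Definition modby N y : lmodType R := quo (im_is_sub (mulby N y)).
Definition modby_proj N y : {linear N -> modby N y} := proj (im_is_sub (mulby N y)).

Lemma modby_onto N y c : exists v, modby_proj N y v = c.
Proof. exact: proj_onto. Qed.

Lemma modby_ann N y : annihilates (modby N y) y.
Proof.
by move=> c; have [v <-] := modby_onto c; rewrite -linZ; apply/proj_eq0; exists v.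
Qed.

Lemma modby_noeth N y : noeth N -> noeth (modby N y).
Proof. by apply: noeth_onto; exact: modby_onto. Qed.

Section Regular.
Variables (N : lmodType R) (y : R).
Hypothesis yreg : forall v : N, y *: v = 0 -> v = 0.

Lemma reg_ses : ses (mulby N y) (modby_proj N y).
Proof. by apply: ses_inj; apply: raddf_inj => v; exact: yreg. Qed.

Lemma reg_exp n (v : N) : y ^+ n *: v = 0 -> v = 0.
Proof. by elim: n => [|n ih]; rewrite ?scale1r // exprS -scalerA => /yreg. Qed.

Lemma reg_dimlt c : dimlt N c.+1 -> dimlt (modby N y) c.
Proof.
apply: (dimlt_regular R_noeth (g := modby_proj N y) (y := y)) => //.
  exact: modby_onto.
exact: modby_ann.
Qed.

Lemma reg_H0 (u : cechH xs 0 N) : y *: u = 0 -> u = 0.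
Proof.
rewrite -(cechH_map_scale (f := mulby N y)) // => hu.
apply: (les_inj0 (cech_ses xs reg_ses)).
by rewrite linear0.
Qed.

Lemma reg_kernel i (u : cechH xs i.+1 N) : y *: u = 0 <->
  exists w, delta (cech_ses xs reg_ses) i w = u.
Proof.
by rewrite -(cechH_map_scale (f := mulby N y) u) //; exact: (les_next (cech_ses xs reg_ses)).
Qed.

Lemma reg_kernel_subquo i : subquo (cechH xs i (modby N y)) (kernel (cechH xs i.+1 N) y).
Proof.
exists (fun w e => delta (cech_ses xs reg_ses) i w = kernel_in _ _ e); split.
- split; first by rewrite !linear0.
  by move=> k w e w' e' h h'; rewrite !linearP h h'.
- by move=> e; rewrite linear0 => he; apply: (@incl_inj _ _ _ (ker_is_sub _)); rewrite linear0.
- by move=> e; apply/reg_kernel; exact: kernel_killed.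
Qed.

Lemma reg_divisible i : trivial (cechH xs i (modby N y)) ->
  forall u : cechH xs i N, exists u', y *: u' = u.
Proof.
move=> hQ u; have /(cechH_exact u reg_ses)[v <-] : cechH_map xs i (modby_proj N y) u = 0.
  exact: hQ.
by exists v; rewrite -(cechH_map_scale (f := mulby N y)).
Qed.

End Regular.

Theorem cechH_vanishing N c i : noeth N -> dimlt N c -> (c <= i)%N -> trivial (cechH xs i N).
Proof.
elim: c N i => [|c ih] N i.
  by move=> _ /(dimlt0 R_noeth) hN _; exact: cechH_trivial.
case: i => // i hN + ci; move: N hN; apply: (devissage (xs := xs)).
- by move=> N _ tN _; exact/cechH_acyc/tors_acyc.
- move=> A B C f g S hB hA hC dB u; have [inj _ on] := S.
  have /(cechH_exact u S)[v <-] : cechH_map xs i.+1 g u = 0 by apply: hC; exact: dimlt_onto dB.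
  by rewrite (hA (dimlt_inj inj dB) v) linear0.
- move=> N y hN yxs yreg dN u.
  (* The kernel of y comes from H^i(N/yN), which vanishes by induction. So y is injective on a
     module that is y-torsion. *)
  have inj (w : cechH xs i.+1 N) : y *: w = 0 -> w = 0.
    move=> /(reg_kernel yreg)[v <-].
    by rewrite (ih _ i (modby_noeth hN) (reg_dimlt yreg dN) ci v) linear0.
  have [n] := cechH_tors u yxs; elim: n => [|n ihn]; first by rewrite scale1r.
  by rewrite exprS -scalerA => /inj.
Qed.

Lemma trivial_dcc V : trivial V -> dcc V.
Proof. by move=> hV X hX _; exists 0%N => k v _ _; rewrite (hV v); apply hX. Qed.

Lemma kernel_trivial W y : (forall w : W, y *: w = 0 -> w = 0) -> trivial (kernel W y).
Proof.
move=> hy e; apply: (@incl_inj _ _ _ (ker_is_sub (mulby W y))).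
by rewrite linear0; apply: hy; exact: kernel_killed.
Qed.

(** For regular y the kernel of y on H^(i+1)(N) is a quotient of H^i(N/yN), artinian by induction,
    so Melkersson's criterion applies. *)
Theorem cechH_dcc N i : noeth N -> dcc (cechH xs i N).
Proof.
elim: i N => [|i ih]; apply: (devissage (xs := xs)).
- move=> N hN tN; have [h [hinj _ _]] := cechH0_incl xs N.
  by apply: (dcc_tors m_local gen (noeth_inj hinj hN)) => v; exact: cechH_tors.
- move=> A B C f g S _; apply: dcc_mid => u; exact: (cechH_exact u S).1.
- move=> N y hN yxs yreg; apply: (@dcc_of_kernel _ _ y); first by move=> u; exact: cechH_tors yxs.
  by apply/trivial_dcc/kernel_trivial; exact: reg_H0.
- by move=> N _ tN; apply/trivial_dcc/cechH_acyc/tors_acyc.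
- move=> A B C f g S _; apply: dcc_mid => u; exact: (cechH_exact u S).1.
- move=> N y hN yxs yreg; apply: (@dcc_of_kernel _ _ y); first by move=> u; exact: cechH_tors yxs.
  by apply: dcc_subquo (reg_kernel_subquo yreg i) _; apply: ih; exact: modby_noeth.
Qed.

Lemma dcc_stable W y (B : W -> Prop) : dcc W -> is_sub B ->
  exists j, forall b, B b -> exists b', B b' /\ y ^+ j *: b = y ^+ j.+1 *: b'.
Proof.
move=> hW hB.
have [||j hj] := hW (fun n w => exists2 b, B b & mulby W (y ^+ n) b = w).
- by move=> n; exact: im_sub_is_sub.
- move=> n w [b Bb <-]; exists (y *: b); first exact: is_subZ.
  by rewrite !mulbyE scalerA exprSr.
exists j => b Bb; have [|b' Bb' hb'] := hj j.+1 (y ^+ j *: b) (leqnSn j).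
  by exists b.
by exists b'.
Qed.

(** For a lift d of e, the element y d lies in the submodule B related to 0. The powers y^n B are
    stationary at some j, so y^(j+1) d = y^(j+1) b' with b' in B, and d - b' is a lift killed by
    y^(j+1). *)
Lemma kernel_lift W Y (r : W -> Y -> Prop) y : dcc W -> lin_rel r ->
  (forall e, exists w, r w e) ->
  exists t, forall e, y *: e = 0 -> exists d, r d e /\ y ^+ t *: d = 0.
Proof.
move=> hW rl ron.
have hB : is_sub (fun w => r w 0).
  split; first by apply rl.
  by move=> k w w' h h'; have := rl.2 k _ _ _ _ h h'; rewrite scaler0 addr0.
have [j hj] := dcc_stable y hW hB; exists j.+1 => e ye0; have [d rd] := ron e.
have [|b' [rb' hb']] := hj (y *: d).
  have := rl.2 y _ _ _ _ rd rl.1; rewrite !addr0 => h.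
  by move: h; rewrite ye0.
exists (d - b'); split; last by rewrite scalerBr -hb' exprSr -scalerA subrr.
by rewrite -[e]subr0; exact: lin_relB.
Qed.

(* Being small of level c excludes the composition factors that distinguish the
   top local cohomology of modules of dimension at least c. *)
Definition small c W := dcc W /\ forall c' N Y (h : {linear cechH xs c' N -> Y}),
  (c <= c')%N -> noeth N -> dimlt N c'.+1 -> (forall y, exists u, h u = y) ->
  subquo W Y -> trivial Y.

Lemma small_subquo c W Y : subquo W Y -> small c W -> small c Y.
Proof.
move=> WY [dW sW]; split; first exact: dcc_subquo WY dW.
by move=> c' N Z h cc' hN dN hon YZ; apply: sW hon _ => //; exact: subquo_trans YZ.
Qed.

Lemma small_trivial c W : trivial W -> small c W.
Proof.
move=> hW; split; first exact: trivial_dcc.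
by move=> c' N Y h _ _ _ _ /subquo_trivial; apply.
Qed.

(** Let Y be a subquotient of B and a quotient of top cohomology. Modulo the part coming from ker g
    it is a subquotient of C, so this part is all of Y; then Y is a subquotient of A. *)
Lemma small_mid c A B C (f : {linear A -> B}) (g : {linear B -> C}) :
  (forall b, g b = 0 -> exists a, f a = b) -> small c A -> small c C -> small c B.
Proof.
move=> ex [dA sA] [dC sC]; split; first exact: dcc_mid ex dA dC.
move=> c' N Y h cc' hN dN hon [r [rl r0 ron]].
have hP : is_sub (fun y => exists2 b, r b y & g b = 0).
  split; first by exists 0; [apply rl | rewrite linear0].
  move=> k y y' [b rb gb] [b' rb' gb']; exists (k *: b + b'); first by apply rl.
  by rewrite linearP gb gb' scaler0 addr0.
have trQ : trivial (quo hP).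
  apply: (sC c' N _ (compl h (proj hP))) => //.
    by move=> q; have [y <-] := proj_onto q; have [u <-] := hon y; exists u.
  exists (fun w q => exists b y, [/\ g b = w, r b y & proj hP y = q]); split.
  - split; first by exists 0, 0; rewrite !linear0; split=> //; apply rl.
    move=> k w q w' q' [b [y [<- rb <-]]] [b' [y' [<- rb' <-]]].
    by exists (k *: b + b'), (k *: y + y'); rewrite !linearP; split=> //; apply rl.
  - by move=> q [b [y [gb rb <-]]]; apply/proj_eq0; exists b.
  - by move=> q; have [y <-] := proj_onto q; have [b rb] := ron y; exists (g b), b, y.
apply: (sA c' N Y h) => //; exists (fun a y => r (f a) y); split.
- by split; [rewrite linear0; apply rl | move=> k a y a' y'; rewrite linearP; apply rl].
- by move=> y; rewrite linear0; exact: r0.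
- move=> y; have /proj_eq0[b rb /ex[a fa]] : proj hP y = 0 by exact: trQ.
  by exists a; rewrite fa.
Qed.

(** Top cohomology is right exact, so dividing Y by the image of the cohomology of A leaves a
    quotient of that of C. *)
Lemma top_split c' A B C (f : {linear A -> B}) (g : {linear B -> C}) Y
    (h : {linear cechH xs c' B -> Y}) : ses f g -> noeth A -> dimlt A c'.+1 ->
  (forall y, exists u, h u = y) ->
  exists Y2 (q : {linear Y -> Y2}) (h2 : {linear cechH xs c' C -> Y2}),
  [/\ forall z, exists y, q y = z, forall z, exists u, h2 u = z
    & forall y, q y = 0 -> exists u, h (cechH_map xs c' f u) = y].
Proof.
move=> S hA dA hon; pose fh := compl (cechH_map xs c' f) h.
have gon := cechH_onto S (cechH_vanishing hA dA (leqnn _)).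
have [u|h2 h2E] := factor_map (h := compl h (proj (im_is_sub fh))) gon.
  by move=> /(cechH_exact u S)[v <-]; rewrite linE; apply/proj_eq0; exists v.
exists (quo (im_is_sub fh)), (proj (im_is_sub fh)), h2; split.
- exact: proj_onto.
- move=> z; have [y <-] := proj_onto z; have [u <-] := hon y.
  by exists (cechH_map xs c' g u); rewrite h2E linE.
- by move=> y /proj_eq0.
Qed.

(** If y is regular on N and dim N ≤ c', then H^c'(N/yN) = 0 for c' > 0, so H^c'(N) is y-divisible
    and has no nonzero quotient killed by a power of y. Torsion modules have no cohomology in
    positive degrees. *)
Lemma small_bounded W : dcc W ->
  (forall x, x \in xs -> exists n, forall w : W, x ^+ n *: w = 0) -> small 1 W.
Proof.
move=> dW bW; split=> // c' N Y h c'pos hN dN hon [r [rl r0 ron]].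
have {W dW bW r rl r0 ron} bY x : x \in xs -> exists n, forall w : Y, x ^+ n *: w = 0.
  move=> /bW[n hn]; exists n => y; have [w rw] := ron y; apply: r0.
  by have := rl.2 (x ^+ n) _ _ _ _ rw rl.1; rewrite !addr0 hn.
move: N hN Y dN h hon bY; case: c' c'pos => // c' _.
apply: (devissage (xs := xs)).
- move=> N _ tN Y _ h hon _ y; have [u <-] := hon y.
  by rewrite (cechH_acyc (tors_acyc tN) u) linear0.
- move=> A B C f g S hB hA hC Y dB h hon bY; have [inj _ on] := S.
  have dA := dimlt_inj inj dB; have dC := dimlt_onto on dB.
  have [Y2 [q [h2 [qon h2on qker]]]] := top_split S (noeth_inj inj hB) dA hon.
  have Y20 : trivial Y2.
    apply: (hC Y2 dC h2 h2on) => x /bY[n hn]; exists n => z.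
    by have [y <-] := qon z; rewrite -linZ hn linear0.
  apply: (hA Y dA (compl (cechH_map xs c'.+1 f) h)) => //.
  by move=> y; apply: qker; exact: Y20.
- move=> N y hN yxs yreg Y dN h hon bY; have [n hn] := bY y yxs.
  have dv : forall u : cechH xs c'.+1 N, exists u', y *: u' = u.
    apply: reg_divisible => //.
    by apply: (cechH_vanishing (modby_noeth hN) (reg_dimlt yreg dN)).
  move=> e; have [u <-] := hon e.
  have [u' <-] : exists u', y ^+ n *: u' = u.
    elim: (n) => [|k [u' <-]]; first by exists u; rewrite scale1r.
    by have [v <-] := dv u'; exists v; rewrite scalerA exprSr.
  by rewrite linZ hn.
Qed.

(** Multiplication by y maps ker y^(t+1) to ker y^t with kernel ker y. *)
Lemma small_kernel_exp c W y : small c (kernel W y) -> forall t, small c (kernel W (y ^+ t)).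
Proof.
move=> s1; elim=> [|t ih].
  by apply/small_trivial/kernel_trivial => w; rewrite scale1r.
have iinj z : injective (kernel_in W z) by exact: incl_inj.
have [e|f fE] := @lift_map _ _ _ _ (kernel_in W (y ^+ t.+1)) (kernel_in W y) (iinj _).
  by apply: kernel_onto; rewrite exprSr -scalerA kernel_killed scaler0.
have [e|g gE] := @lift_map _ _ _ _ (kernel_in W (y ^+ t))
    (compl (kernel_in W (y ^+ t.+1)) (mulby W y)) (iinj _).
  by apply: kernel_onto; rewrite linE mulbyE scalerA -exprSr kernel_killed.
apply: (small_mid (f := f) (g := g)) => // e ge.
have /kernel_onto[d hd] : y *: kernel_in W _ e = 0.
  by have := gE e; rewrite ge linear0 linE mulbyE => <-.
by exists d; apply: (iinj (y ^+ t.+1)); rewrite fE.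
Qed.

Lemma small_kernel_subquo c W Y y : dcc W -> small c (kernel W y) ->
  subquo W Y -> small c (kernel Y y).
Proof.
move=> dW sW [r [rl r0 ron]]; have [t ht] := kernel_lift y dW rl ron.
apply: small_subquo (small_kernel_exp sW t).
exists (fun d e => r (kernel_in W _ d) (kernel_in Y y e)); split.
- split; first by rewrite !linear0; apply rl.
  by move=> k d e d' e'; rewrite !linearP; apply rl.
- move=> e; rewrite linear0 => /r0 he; apply: (@incl_inj _ _ _ (ker_is_sub _)).
  by rewrite linear0.
- move=> e; have [d [rd /kernel_onto[d' hd']]] := ht _ (kernel_killed e).
  by exists d'; rewrite hd'.
Qed.

(** Elements of ker y on Y lift to elements killed by some y^t, which come from H^c'(N/y^t N). The
    image Z of the latter in Y is small of level c and a quotient of top cohomology, hence 0. So y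
    is injective on Y, which is y-torsion. *)
Lemma top_regular_trivial c c' N Y y (h : {linear cechH xs c'.+1 N -> Y}) :
  y \in xs -> (forall v : N, y *: v = 0 -> v = 0) -> (c <= c')%N -> noeth N ->
  dimlt N c'.+2 -> (forall y, exists u, h u = y) -> small c (kernel Y y) -> trivial Y.
Proof.
move=> yxs yreg cc' hN dN hon sY.
have rl : lin_rel (fun u e => h u = e).
  by split=> [|k u e u' e' <- <-]; rewrite ?linear0 ?linearP.
have [t ht] := kernel_lift y (cechH_dcc (i := c'.+1) hN) rl hon.
have zreg := reg_exp yreg (n := t).
pose dh := compl (delta (cech_ses xs (reg_ses zreg)) c') h.
pose Z := subm (im_is_sub dh).
have Z0 : trivial Z.
  have [w|h0 h0E] := lift_map (h := dh) (@incl_inj _ _ _ (im_is_sub dh)).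
    by apply: incl_onto; exists w.
  have [_ sZ] : small c Z.
    apply: small_subquo (small_kernel_exp sY t).
    have [e|f fE] := @lift_map _ _ _ _ (kernel_in Y (y ^+ t)) (incl (im_is_sub dh))
        (@incl_inj _ _ _ (ker_is_sub (mulby Y (y ^+ t)))).
      apply: kernel_onto; have [w <-] := inclP e; rewrite linE -linZ.
      suff -> : y ^+ t *: delta (cech_ses xs (reg_ses zreg)) c' w = 0 by rewrite linear0.
      by apply/(reg_kernel zreg); exists w.
    apply: (subquo_inj (f := f)) => e e' ee'.
    by apply: (@incl_inj _ _ _ (im_is_sub dh)); rewrite -!fE ee'.
  apply: (sZ c' (modby N (y ^+ t)) Z h0) => //.
  - exact: modby_noeth.
  - exact: reg_dimlt.
  - move=> e; have [w we] := inclP e; exists w.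
    by apply: (@incl_inj _ _ _ (im_is_sub dh)); rewrite h0E.
  - exact: subquo_refl.
have inj (e : Y) : y *: e = 0 -> e = 0.
  move=> /ht[d [<- /(reg_kernel zreg)[w <-]]].
  have [|z hz] := @incl_onto _ _ _ (im_is_sub dh) (dh w); first by exists w.
  by rewrite -[LHS]/(dh w) -hz (Z0 z) linear0.
move=> e; have [u ue] := hon e; have [n hn] := cechH_tors u yxs.
have : y ^+ n *: e = 0 by rewrite -ue -linZ hn linear0.
elim: n {hn} => [|n ih]; first by rewrite scale1r.
by rewrite exprS -scalerA => /inj.
Qed.

(** The regular case applied to N / (y-torsion) shows that Y is a quotient of the cohomology of the
    y-torsion of N. Then a power of y kills Y, so Y itself is small of level c. *)
Lemma top_trivial c c' N Y y (h : {linear cechH xs c'.+1 N -> Y}) :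
  y \in xs -> (c <= c')%N -> noeth N -> dimlt N c'.+2 ->
  (forall y, exists u, h u = y) -> dcc Y -> small c (kernel Y y) -> trivial Y.
Proof.
move=> yxs cc' hN dN hon dY sY.
have S := ses_sub (killed_is_sub y N); have [inj _ on] := S.
have hG := noeth_inj inj hN; have dG := dimlt_inj inj dN.
have [Y2 [q [h2 [qon h2on qker]]]] := top_split S hG dG hon.
have Y20 : trivial Y2.
  apply: (top_regular_trivial (c := c) yxs _ cc' _ _ h2on).
  - move=> v; have [w <-] := on v; rewrite -linZ !proj_eq0 => -[n hn].
    by exists n.+1; rewrite exprSr -scalerA.
  - exact: noeth_onto on hN.
  - exact: dimlt_onto on dN.
  - by apply: small_kernel_subquo (subquo_onto qon).
have [n hn] : exists n, forall v : subm (killed_is_sub y N), y ^+ n *: v = 0.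
  apply: noeth_bounded => // v; have [n hn] := inclP v.
  by exists n; apply: inj; rewrite linZ hn linear0.
pose h1 := compl (cechH_map xs c'.+1 (incl (killed_is_sub y N))) h.
have h1on e : exists u, h1 u = e by apply: qker; exact: Y20.
have [_ sY'] : small c Y.
  apply: small_subquo (small_kernel_exp sY n).
  apply: (subquo_onto (g := kernel_in Y (y ^+ n))) => e.
  apply: kernel_onto; have [u <-] := h1on e.
  by rewrite -linZ cechH_killed // linear0.
apply: (sY' c'.+1 _ Y h1) => //; first exact: leq_trans cc' (leqnSn _).
exact: subquo_refl.
Qed.

(** The level rises by one because the test in degree c' + 1 is reduced to a test of the kernel of y
    in degree c'. *)
Lemma small_step c W y : y \in xs -> (forall w : W, killed_by_power y w) ->
  small c (kernel W y) -> small c.+1 W.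
Proof.
move=> yxs ky sW; have [dK _] := sW; have dW := dcc_of_kernel ky dK.
split=> // -[//|c'] N Y h cc' hN dN hon WY.
apply: (top_trivial (c := c) yxs _ hN dN hon) => //.
  exact: dcc_subquo WY dW.
exact: small_kernel_subquo WY.
Qed.

Theorem cechH_small N i : noeth N -> small i.+1 (cechH xs i N).
Proof.
elim: i N => [|i ih]; apply: (devissage (xs := xs)).
- move=> N hN tN; have [h [hinj _ _]] := cechH0_incl xs N.
  have hH := noeth_inj hinj hN; apply: small_bounded; first exact: cechH_dcc.
  by move=> x xxs; apply: noeth_bounded => // u; exact: cechH_tors xxs.
- move=> A B C f g S _; apply: small_mid => u; exact: (cechH_exact u S).1.
- move=> N y hN yxs yreg; apply: (small_step yxs); first by move=> u; exact: cechH_tors yxs.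
  by apply/small_trivial/kernel_trivial; exact: reg_H0.
- by move=> N _ tN; apply/small_trivial/cechH_acyc/tors_acyc.
- move=> A B C f g S _; apply: small_mid => u; exact: (cechH_exact u S).1.
- move=> N y hN yxs yreg; apply: (small_step yxs); first by move=> u; exact: cechH_tors yxs.
  by apply: small_subquo (reg_kernel_subquo yreg i) _; apply: ih; exact: modby_noeth.
Qed.

End LocalCohomologyDimension.

(** * Nonvanishing *)

Section NonVanishing.
Variables (R : comNzRingType) (m : submodClosed R^o) (xs : seq R).
Hypotheses (R_noeth : noeth R^o) (m_local : local_ring m) (gen : generates m xs).
Implicit Types N : lmodType R.

Definition top_dim N d := [/\ exists p, prime_chain N d p, dimlt N d.+1
  & ~ trivial (cechH xs d N)].

Lemma cyc_map (p q : submodClosed R^o) : {subset p <= q} ->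
  exists f : {linear cyc p -> cyc q}, forall v, exists u, f u = v.
Proof.
move=> pq; have [v|f fE] := factor_map (h := cyc_proj q) (@proj_onto _ _ _ (mem_is_sub p)).
  by move=> /proj_eq0/pq vq; exact/proj_eq0.
exists f => v; have [r <-] := @proj_onto _ _ _ (mem_is_sub q) v.
by exists (cyc_proj p r); rewrite fE.
Qed.

(** Every proper ideal containing p lies in a prime, so a prime with no larger prime is maximal. *)
Lemma prime_above_or_max (p : submodClosed R^o) : prime_ideal p ->
  (forall q, prime_ideal q -> {subset p <= q} -> {subset q <= p}) -> p =i m.
Proof.
move=> [p1 pmul] pmax; case: m_local => _; apply; split=> // J pJ J1.
have [|||q [pq Jq _]] := @prime_avoiding _ R_noeth (fun r => r \in J) (fun s => s = 1) (mem_is_sub J).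
- by [].
- by move=> s t -> ->; rewrite mulr1.
- by move=> s ->; exact/negP.
by move=> r /Jq; apply: pmax => // s /pJ /Jq.
Qed.

Lemma cyc_top_dim_step (p q : submodClosed R^o) c :
  prime_ideal p -> {subset p <= q} -> ~ {subset q <= p} -> prime_ideal q ->
  top_dim (cyc q) c -> dimlt (cyc p) c.+2 -> ~ trivial (cechH xs c.+1 (cyc p)).
Proof.
move=> pp pq nqp pr_q [_ _ Hq] dA HA; set A := cyc p in dA HA.
have [f /not_implyP[fq /negP fp]] : exists f : R^o, ~ (f \in q -> f \in p).
  by apply: contrapT => /forallNP h; apply: nqp => r; apply: contrapT; exact: h.
have freg := cyc_regular pp fp; have hA := cyc_noeth (q := p) R_noeth.
have S := reg_ses freg; set N1 := modby A f.
have hN1 : noeth N1 := modby_noeth hA.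
have dN1 : dimlt N1 c.+1 := reg_dimlt R_noeth freg dA.
apply: Hq => u.
have [g gon] := cyc_map pq.
have [v|g1 g1E] := factor_map (h := g) (@modby_onto R A f).
  move=> /proj_eq0[w <-]; rewrite linZ; have /ann_cyc : (f : R^o) \in q by [].
  by apply.
have g1on w : exists v, g1 v = w.
  by have [v <-] := gon w; exists (modby_proj A f v); rewrite g1E.
(* Since dim A/fA ≤ c, top cohomology is right exact and H^c(A/fA) maps onto H^c(R/q). *)
have S1 := ses_onto g1on; have [inj1 _ _] := S1.
have [|v <-] := cechH_onto (xs := xs) (i := c) S1 _ u.
  apply: (cechH_vanishing R_noeth (c := c.+1)) => //; first exact: noeth_inj inj1 hN1.
  exact: dimlt_inj inj1 dN1.
suff N10 : trivial (cechH xs c N1) by rewrite (N10 v) linear0.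
have pion := cechH_onto (xs := xs) (i := c) S HA.
have [j hj] : exists j, forall b : cechH xs c A, True -> exists b', True /\ f ^+ j *: b = f ^+ j.+1 *: b'.
  by apply: dcc_stable; [exact: (cechH_dcc m_local gen hA) | split].
(* In degree 0 there is no connecting map, but there the kernel is trivial. *)
have sK : small xs c (kernel (cechH xs c A) (f ^+ j)).
  have zreg := reg_exp freg (n := j).
  case: (c) => [|c0]; first by apply/small_trivial/kernel_trivial; exact: reg_H0.
  apply: small_subquo (reg_kernel_subquo xs zreg c0) _.
  by apply: (cechH_small R_noeth m_local gen); exact: modby_noeth.
have [_ sY] := sK.
(* The quotient of H^c(A/fA) used in the test is H^c(A/fA) itself, through the identity written as
   multiplication by 1. *)
apply: (sY c N1 _ (mulby _ 1)) => // [w|]; first by exists w; rewrite mulbyE scale1r.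
apply: (subquo_onto (g := compl (kernel_in _ _) (cechH_map xs c (modby_proj A f)))) => y.
have [w <-] := pion y; have [w' [_ hw]] := hj w I.
(* Subtracting f w' puts w into the kernel of f^j without changing its image, as f kills A/fA. *)
have [|k hk] := @kernel_onto _ _ (f ^+ j) (w - f *: w').
  by rewrite scalerBr hw exprSr scalerA subrr.
exists k; rewrite linE hk linB linZ.
suff -> : f *: cechH_map xs c (modby_proj A f) w' = 0 by rewrite subr0.
rewrite -linZ; apply/(cechH_exact _ S); exists w'.
exact: cechH_map_scale.
Qed.

Lemma top_dim_bound N d : top_dim N d -> (d <= size xs)%N.
Proof. by move=> [_ _ Hd]; rewrite leqNgt; apply/negP => /cechH_above/Hd. Qed.

(** Noetherian induction: q is a maximal counterexample, so every strictly larger prime has a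
    dimension with nonvanishing top cohomology. These dimensions are bounded by the number of
    generators of m, and the largest one, c, gives dim R/q = c + 1. *)
Theorem prime_top_dim (p : submodClosed R^o) : prime_ideal p -> exists d, top_dim (cyc p) d.
Proof.
move=> pr_p; apply: contrapT => np.
have [||P [[q [pr_q Pq nq]] Pmax]] := @noeth_max _ _ (fun P => exists q : submodClosed R^o,
    [/\ prime_ideal q, P = (fun r => r \in q) & ~ exists d, top_dim (cyc q) d]) R_noeth.
- by move=> P [q [_ -> _]]; exact: mem_is_sub.
- by exists (fun r => r \in p), p.
have above q' : prime_ideal q' -> {subset q <= q'} -> ~ {subset q' <= q} ->
    exists d, top_dim (cyc q') d.
  move=> pr_q' qq' nq'q; apply: contrapT => nd; apply: nq'q => r rq'.
  have : P r; last by rewrite Pq.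
  apply: (Pmax (fun r => r \in q')) => //; first by exists q'.
  by move=> v; rewrite Pq; exact: qq'.
apply: nq.
pose D d := `[< exists q', [/\ prime_ideal q', {subset q <= q'}, ~ {subset q' <= q}
  & top_dim (cyc q') d] >].
have [exD|noD] := pselect (exists d, D d); last first.
  (* With no prime strictly above, R/q is the residue field: its dimension is 0 and the class of 1
     is torsion, hence a nonzero class in degree 0. *)
  have qm : q =i m.
    apply: prime_above_or_max => // q' pr_q' qq'; apply: contrapT => nq'q.
    by have [d hd] := above _ pr_q' qq' nq'q; apply: noD; exists d; apply/asboolP; exists q'.
  exists 0%N; split.
  - by exists (fun=> q); split=> // i r _ /ann_cyc.
  - move=> [c hc]; have [c1 c2 c3] := hc; have [c01 nc10] := c3 0%N isT.
    have qc := chain_cyc_sub hc.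
    have [||d hd] := above (c 1%N) (c1 1%N isT).
    + by move=> r /qc /c01.
    + by move=> h; apply: nc10 => r /h /qc.
    apply: noD; exists d; apply/asboolP; exists (c 1%N); split=> //; first exact: c1.
      by move=> r /qc /c01.
    by move=> h; apply: nc10 => r /h /qc.
  - have [h [_ _ him]] := cechH0_incl xs (cyc q).
    have /him[u hu] : tors xs (cyc_proj q 1).
      move=> x xxs; exists 1%N; apply/cyc_eq0; rewrite expr1 qm.
      by case: gen => + _; exact.
    move=> /(_ u) u0; have /cyc_eq0 : (1 : R) *: cyc_proj q 1 = 0.
      by rewrite -hu u0 linear0 scaler0.
    by apply/negP; case: pr_q.
have Dle d : D d -> (d <= size xs)%N by move=> /asboolP[q' [_ _ _ /top_dim_bound]].
case: (ex_maxnP exD Dle) => c /asboolP[q' [pr_q' qq' nq'q tq']] cmax.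
have [[c' hc'] dq' _] := tq'.
(* Dropping the first prime of a chain of length c + 2 would leave one of length c + 1 over a prime
   strictly above q, against the choice of c. *)
have dq : dimlt (cyc q) c.+2.
  move=> [e he]; have [e1 e2 e3] := he; have [e01 ne10] := e3 0%N isT.
  have qe := chain_cyc_sub he.
  have qe1 : {subset q <= e 1%N} by move=> r /qe /e01.
  have ne1q : ~ {subset e 1%N <= q} by move=> h; apply: ne10 => r /h /qe.
  have [d hd] := above _ (e1 1%N isT) qe1 ne1q.
  have dc : (d <= c)%N by apply: cmax; apply/asboolP; exists (e 1%N); split=> //; exact: e1.
  have [_ dd _] := hd; apply: (dimlt_le _ dd) (ex_intro _ _ (chain_behead he _)) => //.
  by move=> r /ann_cyc.
exists c.+1; split=> //; last exact: (cyc_top_dim_step pr_q qq' nq'q pr_q' tq' dq).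
have q'c := chain_cyc_sub hc'.
exists (chain_cons q c'); apply: (chain_consP (N' := cyc q')) hc' => //.
- by move=> r /ann_cyc.
- by move=> r /qq' /q'c.
- by move=> h; apply: nq'q => r /q'c /h.
- by move=> r /ann_cyc /qq' /ann_cyc.
Qed.

(** A longest chain starts at a prime p with dim R/p = dim N = d. A nonzero map from N to R/p with
    image J gives surjections of H^d(N) onto H^d(J) and of H^d(J) onto H^d(R/p) ≠ 0. *)
Theorem module_top_dim N s : @generated_by R N s -> ~ trivial N -> exists d, top_dim N d.
Proof.
move=> gN nN; have hN := generated_noeth R_noeth gN.
pose D d := `[< exists p, prime_chain N d p >].
have exD : exists d, D d.
  exists 0%N; apply/asboolP; apply: contrapT => /(dimlt0 R_noeth); exact: nN.
have Dprime d : D d -> exists p, [/\ prime_ideal p, forall r, annihilates N r -> (r : R^o) \in p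
    & exists e, (d <= e)%N /\ top_dim (cyc p) e].
  move=> /asboolP[c hc]; have [c1 c2 c3] := hc; exists (c 0%N); split; first exact: c1.
    by move=> r; exact: c2.
  have [e he] := prime_top_dim (c1 0%N isT); exists e; split=> //.
  rewrite leqNgt; apply/negP => ed; have [_ de _] := he.
  apply: (dimlt_le ed de); exists c; apply: chain_weaken hc _.
  by move=> r /ann_cyc.
have Dle d : D d -> (d <= size xs)%N.
  by move=> /Dprime[p [_ _ [e [de /top_dim_bound]]]]; exact: leq_trans.
case: (ex_maxnP exD Dle) => d Dd dmax.
have dN : dimlt N d.+1.
  by move=> /asboolP/dmax; rewrite ltnn.
have [p [pr_p Np [e [de tp]]]] := Dprime d Dd.
have [[c hc] _ _] := tp.
have ed : e = d.
  apply/eqP; rewrite eqn_leq de andbT; apply: dmax; apply/asboolP; exists c.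
  by apply: (chain_weaken hc) => r /Np; exact: chain_cyc_sub hc r.
move: tp; rewrite {}ed => -[_ dp Hp] {e de c hc}.
exists d; split=> //; first exact/asboolP.
have [f [v fv]] := nonzero_map_cyc gN pr_p Np.
move=> HN; apply: Hp.
pose J := im_is_sub f.
have [w|f' f'E] := lift_map (h := f) (@incl_inj _ _ _ J).
  by apply: incl_onto; exists w.
have f'on w : exists v, f' v = w.
  have [u uw] := inclP w; exists u.
  by apply: (@incl_inj _ _ _ J); rewrite f'E.
have hp := cyc_noeth (q := p) R_noeth.
have S1 := ses_onto f'on; have [inj1 _ _] := S1.
have HJ : trivial (cechH xs d (subm J)).
  move=> u; have [|w <-] := cechH_onto (xs := xs) (i := d) S1 _ u; last by rewrite (HN w) linear0.
  apply: (cechH_vanishing R_noeth (c := d.+1)) => //; first exact: noeth_inj inj1 hN.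
  exact: dimlt_inj inj1 dN.
have S2 := ses_sub J; have [inj2 _ on2] := S2.
(* The quotient of R/p by J is killed by some r outside p, which is regular on R/p; so its dimension
   is below d and its H^d vanishes. *)
move=> u; have /(cechH_exact u S2)[w <-] : cechH_map xs d (proj J) u = 0.
  have [r rv] := cyc_gen (f v).
  have rp : (r : R^o) \notin p by apply/negP => /cyc_eq0 h; apply: fv; rewrite rv h.
  apply: (cechH_vanishing R_noeth (c := d)) => //; first exact: noeth_onto on2 hp.
  apply: (dimlt_regular R_noeth on2 (y := r)) dp; first exact: cyc_regular.
  move=> z; have [y <-] := on2 z; have [t ->] := cyc_gen y.
  rewrite -linZ scalerA mulrC -scalerA -rv; apply/proj_eq0.
  by exists (t *: v); rewrite linZ.
by rewrite (HJ w) linear0.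
Qed.

End NonVanishing.

(** * The tower of the M / a^n M *)

Import Order.TTheory Num.Theory.
Local Open Scope classical_set_scope.

Lemma supremum_max d (T : porderType d) (x0 x : T) (A : set T) :
  A x -> (forall y, A y -> (y <= x)%O) -> supremum x0 A = x.
Proof.
move=> Ax leA; rewrite /supremum; case: ifPn => [/eqP A0|_]; first by rewrite A0 in Ax.
have supx : supremums A x by split=> [y /leA //|y]; apply.
apply: xget_unique => // y [uby lby]; apply/le_anti/andP; split; first exact: lby supx.1.
exact: uby.
Qed.

Section Tower.
Variables (R : comNzRingType) (a : submodClosed R^o) (M : lmodType R).

Lemma ideal_smul_ind (I : submodClosed R^o) (P : M -> Prop) : is_sub P ->
  (forall (c : R) v, (c : R^o) \in I -> P (c *: v)) ->
  forall w, w \in ideal_smul I (full_submodule M) -> P w.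
Proof.
move=> hP PI w /asboolP[n [r [v [rI _ ->]]]].
apply: (@big_ind _ P); first by apply hP.
  by move=> y z; exact: is_subD.
by move=> i _; exact: PI.
Qed.

Lemma ideal_smul_mem (I : submodClosed R^o) (c : R) v :
  (c : R^o) \in I -> c *: v \in ideal_smul I (full_submodule M).
Proof.
by move=> cI; apply/asboolP; exists 1%N, (fun=> c), (fun=> v); rewrite big_ord1.
Qed.

Lemma ann_quotient (N : submodClosed M) (r : R) :
  annihilates (quotient_by N) r <-> forall v, r *: v \in N.
Proof.
have E v : r *: coset N v = 0 <-> r *: v \in N.
  rewrite -linearZ -(linear0 (coset N)) -[r *: v in X in _ <-> X]subr0.
  by split=> h; apply/cosetP.
split=> [h v|h q]; first exact/E.
by rewrite -[q]coset_repr; apply/E.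
Qed.

Local Notation Q := (quotient_by (ideal_smul a (full_submodule M))).

Lemma ann_tower n (r : R) : annihilates Q r -> annihilates (quot_exp a M n) (r ^+ n).
Proof.
move=> /ann_quotient hr; apply/ann_quotient; elim: n => [|n ih] v.
  exact: ideal_smul_mem.
rewrite exprS -scalerA; move: (_ *: v) (ih v) => w.
apply: (ideal_smul_ind (P := fun w => r *: w \in _)).
  apply: (preim_is_sub (mulby M r) (P := fun w => w \in _)).
  exact: mem_is_sub.
move=> c u cn; rewrite scalerA mulrC -scalerA; move: (_ *: u) (hr u).
apply: (ideal_smul_ind (P := fun w => c *: w \in _)).
  apply: (preim_is_sub (mulby M c) (P := fun w => w \in _)).
  exact: mem_is_sub.
move=> b w' ba; rewrite scalerA mulrC; apply: ideal_smul_mem.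
exact: ideal_exp_mul.
Qed.

Lemma ann_base n (r : R) : annihilates (quot_exp a M n.+1) r -> annihilates Q r.
Proof.
move=> /ann_quotient hr; apply/ann_quotient => v.
apply: ideal_smulS (hr v) => c /asboolP[k [b [c' [ba _ ->]]]].
apply: rpred_sum => i _.
by rewrite -[_ *: _]/(b i * c' i) mulrC; apply: (@rpredZ R R^o a (c' i) (b i)).
Qed.

(** The two annihilators have the same radical, so they lie in the same primes. The index starts at
    1 because M/a^0 M is zero. *)
Lemma chain_tower n k p : prime_chain Q k p <-> prime_chain (quot_exp a M n.+1) k p.
Proof.
split=> -[p1 p2 p3]; split=> // i r ik.
  by move=> /ann_base; exact: p2.
move=> hr; have := p2 i _ ik (@ann_tower n.+1 r hr); have [_ pmul] := p1 i ik.
by elim: (n) => [|j ih]; rewrite ?expr1 // exprS => /pmul[].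
Qed.

Lemma generated_tower n : finitely_generated (full_submodule M) ->
  exists s, @generated_by R (quot_exp a M n) s.
Proof.
move=> [k [v hv]].
exists (map (coset (ideal_smul (ideal_exp a n) (full_submodule M))) (codom v)).
move=> P hP hs q; rewrite -[q]coset_repr.
have /hv[r ->] : repr q \in full_submodule M by [].
rewrite linear_sum; apply: (@big_ind _ P); first by apply hP.
  by move=> y z; exact: is_subD.
move=> i _; rewrite linearZ; apply: is_subZ => //; apply: hs.
by apply: map_f; exact: codom_f.
Qed.

Lemma tower_onto n (q : quot_exp a M n) : exists q', quot_exp_proj a M n q' = q.
Proof.
exists (coset _ (repr q)).
by rewrite -[RHS]coset_repr; exact: (quot_mapE (@quot_exp_homo R a M n)).
Qed.

End Tower.

(** Surjectivity lets [x1] be lifted along the tower by chosen sections. It sits at index 1, the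
    first level that can be nonzero in the application. *)
Lemma inverse_limit_nonzero (R : pzRingType) (L : nat -> lmodType R)
    (t : forall n, {linear L n.+1 -> L n}) (x1 : L 1%N) :
  (forall n y, exists x, t n x = y) -> x1 <> 0 -> nonzero_module (inverse_limit t).
Proof.
move=> ton x1n0.
have ex n : exists s : L n -> L n.+1, forall y, t n (s y) = y.
  by have [s hs] := choice (ton n); exists s.
pose s n := projT1 (cid (ex n)).
have sP n y : t n (s n y) = y by rewrite /s; case: cid.
pose fix y n : L n.+1 := if n is k.+1 then s k.+1 (y k) else x1.
pose x : seq_prod L := fun n => if n is k.+1 then y k else t 0%N x1.
have xc : x \in @compatible_pred _ L t by apply/asboolP => -[|n] //=; exact: sP.
exists (Sub x xc) => /(congr1 val)/(congr1 (fun z : seq_prod L => z 1%N)).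
exact: x1n0.
Qed.

Theorem theorem1p1 (R : comNzRingType) (m : submodClosed R^o)
  (R_noetherian : noetherian R) (R_local : local_ring m)
  (a : submodClosed R^o) (M : lmodType R)
  (M_fg : finitely_generated (full_submodule M))
  (I : forall n, injective_resolution (quot_exp a M n))
  (phi : forall n, resolution_lift (quot_exp_proj a M n) (I n.+1) (I n)) :
  krull_dim (quotient_by (ideal_smul a (full_submodule M))) =
  supremum -oo%E
    [set i%:E | i in [set i : int | nonzero_module
      (inverse_limit (fun n => local_cohomology_map m (phi n) i))]].
Proof.
have hR := noetherian_noeth R_noetherian.
have [xs gen] := exists_generates m R_noetherian.
have lim0 i : (forall n, trivial (local_cohomology m (I n) i)) ->
    ~ nonzero_module (inverse_limit (fun n => local_cohomology_map m (phi n) i)).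
  move=> h0 [x]; apply; apply: val_inj.
  by apply: functional_extensionality_dep => n; rewrite (h0 n (val x n)).
have lim0N k : ~ nonzero_module
    (inverse_limit (fun n => local_cohomology_map m (phi n) (Negz k))).
  by apply: lim0 => n v; exact: rV0_eq0.
(* If M/aM = 0, all modules of the tower vanish and both suprema are taken over the empty set. *)
have [N1|N1] := pselect (trivial (quot_exp a M 1)).
  have Q1 : annihilates (quotient_by (ideal_smul a (full_submodule M))) (1 : R).
    by apply: (@ann_base _ _ _ 0) => v; rewrite (N1 v) scaler0.
  have Nn n : trivial (quot_exp a M n).
    by move=> v; have := @ann_tower _ _ _ n _ Q1 v; rewrite expr1n scale1r.
  rewrite /krull_dim; congr (supremum _ _); apply/seteqP; split=> x.
    move=> [k [p [p1 p2 _]] _]; have [/negP[]] := p1 0%N isT.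
    exact: p2.
  move=> [[k|k] hk _]; last by case: (lim0N k).
  case: (lim0 k _ hk) => n; apply/(lc_trivial (I n) hR gen).
  exact: cechH_trivial.
have [s gs] := generated_tower a 1 M_fg.
have [d [[p hp] dN1 Hd]] := module_top_dim hR R_local gen gs N1.
have dN n : dimlt (quot_exp a M n) d.+1.
  move=> [c hc]; case: n c hc => [|n] c hc.
    have [c1 c2 _] := hc; have [/negP[]] := c1 0%N isT; apply: c2 => //.
    by apply/ann_quotient => v; exact: ideal_smul_mem.
  by apply: dN1; exists c; exact: (@chain_tower _ a M 0 _ c).1 ((@chain_tower _ a M n _ c).2 hc).
have hN n : noeth (quot_exp a M n).
  by have [s' /generated_noeth] := generated_tower a n M_fg; apply.
transitivity (d%:Z%:E).
  apply: supremum_max; first by exists d => //; exists p; exact: (@chain_tower _ a M 0 _ p).2.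
  move=> _ [k [c /(@chain_tower _ a M 0) hc] <-]; rewrite lee_fin lez_nat leqNgt.
  apply/negP => dk; apply: (dimlt_le dk dN1); by exists c.
(* In degree d the kernels of the projections have dimension at most d, so the transition maps are
   onto and a nonzero class at level 1 lifts. In higher degrees every term vanishes. *)
apply/esym/supremum_max.
  exists d%:Z => //=.
  have [x x0] : exists x : local_cohomology m (I 1%N) d, x <> 0.
    apply: contrapT => /forallNP h; apply: Hd.
    by apply/(lc_trivial (I 1%N) hR gen) => x; apply: contrapT; exact: h.
  apply: inverse_limit_nonzero x0 => n.
  apply: (lc_onto (phi n) hR gen).
  have S := ses_onto (@tower_onto _ a M n); have [inj _ _] := S.
  apply: (cechH_onto S); apply: (cechH_vanishing hR (c := d.+1)) => //.
    exact: noeth_inj inj (hN _).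
  exact: dimlt_inj inj (dN _).
move=> _ [[k|k] hk <-]; last by case: (lim0N k).
rewrite lee_fin lez_nat leqNgt; apply/negP => dk.
case: (lim0 k _ hk) => n; apply/(lc_trivial (I n) hR gen).
exact: (cechH_vanishing hR (hN n) (dN n) dk).
Qed.
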